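(* For every special poset $P$, applying repeatedly, starting from $P$, the transformations (T1) and (T2) described in the context, one can obtain in finitely many steps a linear combination of heap-ordered forests, and this linear combination does not depend on the way the transformations are performed (any two elements of $\mathcal{H}_{\mathcal{HOF}}$ obtained from $P$ in this way are equal). Denote it by $\Upsilon(P)\in\mathcal{H}_{\mathcal{HOF}}$ and extend $\Upsilon$ linearly to $\mathcal{H}_{\mathcal{SP}}$. Then $\Upsilon:\mathcal{H}_{\mathcal{SP}}\to\mathcal{H}_{\mathcal{HOF}}$ is a Hopf algebra morphism such that $\Theta_{\mid \mathcal{H}_{\mathcal{HOF}}}\circ\Upsilon=\Theta$. The restriction $\Theta_{\mid\mathcal{H}_{\mathcal{HOF}}}:\mathcal{H}_{\mathcal{HOF}}\to\mathbf{FQSym}$ is an isomorphism, and $\Upsilon_{\mid\mathcal{H}_{\mathcal{HOF}}}=\mathrm{Id}_{\mathcal{H}_{\mathcal{HOF}}}$. Moreover $\langle\Upsilon(x),\Upsilon(y)\rangle=\langle x,y\rangle$ for all $x,y\in\mathcal{H}_{\mathcal{SP}}$.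
   Context: $\mathbb{K}$ is a commutative field. Special posets. A double poset is a finite set with two partial orders $(P,\leq_1,\leq_2)$, considered up to isomorphism (bijections preserving and reflecting both orders). Subsets are double posets by restriction. It is special if $\leq_2$ is total; when it has $n$ elements we identify $(P,\leq_2)$ with $\{1,\ldots,n\}$ with its usual order. $\mathcal{SP}$ is the set of (isoclasses of) special posets. A special poset is an ordered forest if $(P,\leq_1)$ is a rooted forest, roots being minimal (i.e. for each $x$, $\{y: y\leq_1 x\}$ is totally ordered by $\leq_1$); it is heap-ordered if $x\leq_1 y$ implies $x\leq_2 y$. $\mathcal{HOF}$ is the set of heap-ordered forests (ordered forests that are heap-ordered). Hopf algebra. $\mathcal{H}_{\mathcal{SP}}$ is the $\mathbb{K}$-vector space with basis $\mathcal{SP}$, graded by cardinality. The product $PQ$ is the disjoint union of $P$ and $Q$, with $P,Q$ as double subposets, $x\leq_2 y$ for all $x\in P,y\in Q$, and no element of $P$ being $\leq_1$-comparable with an element of $Q$; the unit is the empty poset. The coproduct is $\Delta(P)=\sum_I (P\setminus I)\otimes I$, over the ideals $I$ of $P$, i.e. subsets $I$ such that $x\in I$, $x\leq_1 y$ imply $y\in I$. $\mathcal{H}_{\mathcal{HOF}}$, the span of $\mathcal{HOF}$, is a Hopf subalgebra. Pairing. $\langle P,Q\rangle$ is the number of bijections $\sigma:P\to Q$ such that, for all $i,j\in P$, ($i\leq_1 j$ in $P$) implies ($\sigma(i)\leq_2\sigma(j)$ in $Q$), and ($\sigma(i)\leq_1\sigma(j)$ in $Q$) implies ($i\leq_2 j$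 in $P$). This is extended bilinearly to $\mathcal{H}_{\mathcal{SP}}$. $\mathbf{FQSym}$ is the Hopf algebra with basis $\bigsqcup_{n\geq0}\mathfrak{S}_n$ (permutations written as words $\sigma(1)\ldots\sigma(n)$). The product of $\sigma\in\mathfrak{S}_k$ and $\tau\in\mathfrak{S}_l$ is the sum of all shuffles of the word $\sigma$ with the word $\tau$ whose letters are shifted by $k$. The coproduct is $\Delta(\sigma)=\sum_{k=0}^n\sigma_1^{(k)}\otimes\sigma_2^{(k)}$, where $\sigma_1^{(k)},\sigma_2^{(k)}$ are the standardizations of $\sigma(1)\ldots\sigma(k)$ and $\sigma(k+1)\ldots\sigma(n)$. The Hopf algebra morphism $\Theta:\mathcal{H}_{\mathcal{SP}}\to\mathbf{FQSym}$ is $\Theta(P)=\sum_{\sigma\in S_P}\sigma$, where for $P$ with $n$ elements (identified with $\{1,\ldots,n\}$) $S_P$ is the set of linear extensions of $P$: the $\sigma\in\mathfrak{S}_n$ such that $i<_1 j$ implies $\sigma^{-1}(i)<\sigma^{-1}(j)$. Transformations. For a special poset $Q$ let $R_Q$ be the set of edges of the Hasse graph of $(Q,\leq_1)$: pairs $(a,b)$ with $a\neq b$ and $\{c: a\leq_1 c\leq_1 b\}=\{a,b\}$. For an acyclic relation $R$ on the set $Q$, let $Q[R]$ be the special poset with the same underlying set and same $\leq_2$ as $Q$, whose first order is the reflexive-transitive closure of $R$. A step on an element $x=\sum_Q c_Q Q$ of $\mathcal{H}_{\mathcal{SP}}$ consists of choosing $Q$ with $c_Q\ne0$ and replacing $Q$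 in $x$ by one of the following (when applicable): (T1) if $i<_2 j$ and $(j,i)\in R_Q$: $Q\mapsto Q[R_Q\setminus\{(j,i)\}]-Q[(R_Q\setminus\{(j,i)\})\cup\{(i,j)\}]$; (T2) if $i<_2 j<_2 k$ and $(i,k),(j,k)\in R_Q$: $Q\mapsto Q[R_Q\setminus\{(j,k)\}]-Q[(R_Q\setminus\{(j,k)\})\cup\{(i,j)\}]+Q[(R_Q\setminus\{(j,k),(i,k)\})\cup\{(i,j),(j,k)\}]$. *)

(* Defs.v *)
From HB Require Import structures.
From mathcomp Require Import all_boot all_order all_algebra all_fingroup.
From mathcomp Require Import finmap.
From mathcomp.multinomials Require Import monalg.

Set Implicit Arguments.
Unset Strict Implicit.
Unset Printing Implicit Defensive.

Import GRing.Theory.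
Local Open Scope ring_scope.

Section FreeSpaces.
Variable K : fieldType.

Definition linext (B : choiceType) (V : lmodType K) (f : B -> V)
  (x : {malg K[B]}) : V := \sum_(b <- msupp x) x@_b *: f b.

Lemma linextEw (B : choiceType) (V : lmodType K) (f : B -> V)
    (x : {malg K[B]}) (d : {fset B}) :
  (msupp x `<=` d)%fset -> linext f x = \sum_(b <- d) x@_b *: f b.
Proof.
move=> le_xd; rewrite /linext (big_fset_incl _ le_xd) // => b _ /mcoeff_outdom.
by move=> ->; rewrite scale0r.
Qed.

Fact linext_is_linear (B : choiceType) (V : lmodType K) (f : B -> V) :
  linear (linext f).
Proof.
move=> a x y; pose d := (msupp (a *: x + y) `|` (msupp x `|` msupp y))%fset.
rewrite !(@linextEw B V f _ d); last 3 first.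
- by rewrite fsubsetU // fsubsetU ?fsubset_refl ?orbT.
- by rewrite fsubsetU // fsubsetU ?fsubset_refl ?orbT.
- by rewrite fsubsetU // fsubset_refl.
rewrite scaler_sumr -big_split /=; apply: eq_bigr => b _.
by rewrite mcoeffD mcoeffZ scalerDl scalerA.
Qed.

HB.instance Definition _ (B : choiceType) (V : lmodType K) (f : B -> V) :=
  GRing.isLinear.Build K {malg K[B]} V _ (linext f) (linext_is_linear f).

(* The tensor product of the spaces with bases [A] and [B] is the space with
   basis [A * B]. *)
Definition tens (A B : choiceType) (x : {malg K[A]}) (y : {malg K[B]}) :
    {malg K[(A * B)%type]} :=
  linext (fun a => linext (fun b => << (a, b) >>) y) x.

Definition tensmap (A B : choiceType) (f : {malg K[A]} -> {malg K[B]}) :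
    {malg K[(A * A)%type]} -> {malg K[(B * B)%type]} :=
  linext (fun p => tens (f << p.1 >>) (f << p.2 >>)).

End FreeSpaces.

(* The structure maps of a Hopf algebra, given by their values on a basis.  The
   antipode is not recorded: it is determined by the other maps, and morphisms
   of bialgebras between Hopf algebras commute with the antipodes. *)
Record based_hopf (K : fieldType) := BasedHopf {
  hbasis : choiceType;
  hone1 : hbasis;
  hmul1 : hbasis -> hbasis -> {malg K[hbasis]};
  hcounit1 : hbasis -> K;
  hcomul1 : hbasis -> {malg K[(hbasis * hbasis)%type]}
}.

Section HopfMorphisms.
Variable K : fieldType.

Definition hspace (A : based_hopf K) : lmodType K := {malg K[hbasis A]}.

Definition hone (A : based_hopf K) : hspace A := << hone1 A >>.

Definition hmul (A : based_hopf K) (x y : hspace A) : hspace A :=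
  linext (fun a : hbasis A => linext (fun b : hbasis A => hmul1 a b) y) x.

Definition hcounit (A : based_hopf K) : hspace A -> K^o :=
  linext (fun a : hbasis A => hcounit1 a : K^o).

Definition hcomul (A : based_hopf K) :
    hspace A -> {malg K[(hbasis A * hbasis A)%type]} :=
  linext (@hcomul1 K A).

Definition hopf_morphism (A B : based_hopf K)
    (f : {linear hspace A -> hspace B}) : Prop :=
  [/\ f (hone A) = hone B,
      forall x y, f (hmul x y) = hmul (f x) (f y),
      forall x, hcounit (f x) = hcounit x &
      forall x, hcomul (f x) = tensmap f (hcomul x)].

Definition hopf_isomorphism (A B : based_hopf K)
    (f : {linear hspace A -> hspace B}) : Prop :=
  hopf_morphism f /\ bijective f.

End HopfMorphisms.

Section Orders.
Variable n : nat.
Implicit Types (R : {set 'I_n * 'I_n}).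

Definition is_order R : bool :=
  [&& [forall x, (x, x) \in R],
      [forall x, forall y, ((x, y) \in R) && ((y, x) \in R) ==> (x == y)] &
      [forall x, forall y, forall z,
        ((x, y) \in R) && ((y, z) \in R) ==> ((x, z) \in R)]].

Lemma is_orderP R :
  reflect [/\ forall x, (x, x) \in R,
              forall x y, (x, y) \in R -> (y, x) \in R -> x = y &
              forall y x z, (x, y) \in R -> (y, z) \in R -> (x, z) \in R]
          (is_order R).
Proof.
apply: (iffP and3P) => -[H1 H2 H3]; split.
- exact/forallP.
- move=> x y Rxy Ryx; apply/eqP; move/forallP/(_ x)/forallP/(_ y)/implyP: H2.
  by apply; rewrite Rxy.
- move=> y x z Rxy Ryz.
  move/forallP/(_ x)/forallP/(_ y)/forallP/(_ z)/implyP: H3.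
  by apply; rewrite Rxy.
- exact/forallP.
- apply/forallP => x; apply/forallP => y; apply/implyP => /andP[Rxy Ryx].
  by apply/eqP/H2.
- apply/forallP => x; apply/forallP => y; apply/forallP => z; apply/implyP.
  by case/andP=> Rxy; apply: H3.
Qed.

Record partial_order :=
  PartialOrder { po_set : {set 'I_n * 'I_n}; _ : is_order po_set }.

HB.instance Definition _ := [isSub for po_set].
HB.instance Definition _ := [Choice of partial_order by <:].

Definition ole (P : partial_order) (x y : 'I_n) : bool := (x, y) \in po_set P.

Lemma oleP (P : partial_order) :
  [/\ reflexive (ole P), antisymmetric (ole P) & transitive (ole P)].
Proof.
have /is_orderP[H1 H2 H3] := valP P; split=> [x|x y /andP[]|y x z].
- exact: H1.
- exact: H2.
- exact: H3.
Qed.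

Lemma discrete_is_order : is_order [set p | p.1 == p.2].
Proof.
by apply/is_orderP; split=> [x|x y|y x z]; rewrite !inE //= => /eqP-> // /eqP->.
Qed.

Definition discrete : partial_order := PartialOrder discrete_is_order.

Definition rtclosure R : {set 'I_n * 'I_n} :=
  [set p | connect [rel x y | (x, y) \in R] p.1 p.2].

Definition acyclic R : bool :=
  [forall p in R, ~~ connect [rel x y | (x, y) \in R] p.2 p.1].

Lemma acyclicP R :
  reflect (forall x y, (x, y) \in R -> ~~ connect [rel x y | (x, y) \in R] y x)
          (acyclic R).
Proof.
by apply: (iffP forall_inP) => [H x y /H //|H [x y] /H].
Qed.

Lemma acyclic_is_order R : acyclic R -> is_order (rtclosure R).
Proof.
move/acyclicP=> acR; apply/is_orderP; split=> [x|x y|y x z]; rewrite !inE /=.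
- exact: connect0.
- case/connectP=> [[|z p]] /=; first by move=> _ ->.
  case/andP=> Rxz pP y_last Ryx; case/negP: (acR _ _ Rxz).
  by apply: connect_trans Ryx; apply/connectP; exists p.
- exact: connect_trans.
Qed.

(* The junk value [discrete] is only taken when the closure of [R] is not an
   order, hence never for acyclic [R]. *)
Definition generated R : partial_order := insubd discrete (rtclosure R).

Lemma generatedE R : acyclic R -> po_set (generated R) = rtclosure R.
Proof. by move/acyclic_is_order => RP; apply: insubdK. Qed.

Definition hasse (P : partial_order) : {set 'I_n * 'I_n} :=
  [set e | (e.1 != e.2) &&
           ([set c | ole P e.1 c && ole P c e.2] == [set e.1; e.2])].

Definition T1_applicable (P : partial_order) (i j : 'I_n) : bool :=
  (i < j)%N && ((j, i) \in hasse P).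

Definition T1_rel1 (P : partial_order) (i j : 'I_n) := hasse P :\ (j, i).
Definition T1_rel2 (P : partial_order) (i j : 'I_n) :=
  (i, j) |: (hasse P :\ (j, i)).

Definition T2_applicable (P : partial_order) (i j k : 'I_n) : bool :=
  [&& (i < j)%N, (j < k)%N, (i, k) \in hasse P & (j, k) \in hasse P].

Definition T2_rel1 (P : partial_order) (i j k : 'I_n) := hasse P :\ (j, k).
Definition T2_rel2 (P : partial_order) (i j k : 'I_n) :=
  (i, j) |: (hasse P :\ (j, k)).
Definition T2_rel3 (P : partial_order) (i j k : 'I_n) :=
  (hasse P :\: [set (j, k); (i, k)]) :|: [set (i, j); (j, k)].

(* The relations above are acyclic, so that [generated] is used on them in its
   intended domain. *)

Lemma hasseP (P : partial_order) a b : (a, b) \in hasse P ->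
  [/\ ole P a b, a != b & forall c, ole P a c -> ole P c b -> c = a \/ c = b].
Proof.
rewrite inE /= => /andP[neq_ab /eqP/setP def_ab].
have E c : ole P a c && ole P c b = (c == a) || (c == b).
  by have := def_ab c; rewrite !inE.
split=> // [|c ac cb]; last first.
  by have := E c; rewrite ac cb => /esym/orP[]/eqP; [left|right].
by have := E b; rewrite eqxx orbT => /andP[].
Qed.

Lemma connect_hasse (P : partial_order) R x y : R \subset hasse P ->
  connect [rel x y | (x, y) \in R] x y -> ole P x y.
Proof.
have [le_refl _ le_tr] := oleP P.
move=> /subsetP sRP /connectP[p].
elim: p x => [|z p IHp] x /=; first by move=> _ ->.
case/andP=> /sRP/hasseP[xz _ _] pP y_last; apply: le_tr xz _.
exact: IHp.
Qed.

Lemma acyclic_hasse (P : partial_order) R : R \subset hasse P -> acyclic R.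
Proof.
move=> sRP; apply/acyclicP => x y Rxy; apply/negP => /(connect_hasse sRP) yx.
have [xy /eqP neq_xy _] := hasseP (subsetP sRP _ Rxy).
have [_ le_anti _] := oleP P.
by apply/neq_xy/le_anti; rewrite xy.
Qed.

Lemma connect_add R i j x y :
  connect [rel x y | (x, y) \in (i, j) |: R] x y ->
  connect [rel x y | (x, y) \in R] x y \/
  connect [rel x y | (x, y) \in R] x i /\ connect [rel x y | (x, y) \in R] j y.
Proof.
case/connectP=> p; elim: p x => [|z p IHp] x /=.
  by move=> _ ->; left; apply: connect0.
rewrite in_setU1 => /andP[xz pP y_last].
case/orP: xz => [/eqP[-> eq_zj]|Rxz].
  right; split; first exact: connect0.
  by case: (IHp _ pP y_last) => [|[]]; rewrite eq_zj.
have xz : connect [rel x y | (x, y) \in R] x z by apply: connect1.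
case: (IHp _ pP y_last) => [zy|[zi jy]].
  by left; apply: connect_trans zy.
by right; split=> //; apply: connect_trans zi.
Qed.

Lemma acyclic_add R i j : acyclic R ->
  ~~ connect [rel x y | (x, y) \in R] j i -> acyclic ((i, j) |: R).
Proof.
move=> /acyclicP acR nji; apply/acyclicP => x y; rewrite in_setU1.
case/orP=> [/eqP[-> ->]|Rxy]; apply/negP => /connect_add.
  by case=> [ji|[ji _]]; rewrite ji in nji.
case=> [yx|[yi jx]]; first by case/negP: (acR _ _ Rxy).
case/negP: nji; apply: connect_trans jx _; apply: connect_trans yi.
exact: connect1.
Qed.

Lemma T1_acyclic (P : partial_order) i j : T1_applicable P i j ->
  acyclic (T1_rel1 P i j) && acyclic (T1_rel2 P i j).
Proof.
case/andP=> _ Rji; have sub : hasse P :\ (j, i) \subset hasse P by apply: subD1set.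
rewrite (acyclic_hasse sub) acyclic_add ?(acyclic_hasse sub) //.
have [_ neq_ji no_mid] := hasseP Rji; apply/negP => /connectP[[|c p]] /=.
  by move=> _ eq_ij; rewrite eq_ij eqxx in neq_ji.
rewrite !inE -andbA => /and3P[neq_c Rjc pP] i_last.
have Rjc' : (j, c) \in hasse P by rewrite inE.
have [jc neq_jc _] := hasseP Rjc'.
have ci : ole P c i by apply: (connect_hasse sub); apply/connectP; exists p.
by case: (no_mid c jc ci) => eq_c; move: neq_c neq_jc; rewrite eq_c eqxx.
Qed.

Lemma T2_acyclic (P : partial_order) i j k : T2_applicable P i j k ->
  [&& acyclic (T2_rel1 P i j k), acyclic (T2_rel2 P i j k)
    & acyclic (T2_rel3 P i j k)].
Proof.
case/and4P=> lt_ij lt_jk Rik Rjk.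
have nji R : R \subset hasse P -> ~~ connect [rel x y | (x, y) \in R] j i.
  move=> sRP; apply/negP => /(connect_hasse sRP) ji.
  have [ik _ _] := hasseP Rik; have [_ _ no_mid] := hasseP Rjk.
  case: (no_mid i ji ik) => eq_i; move: lt_ij (ltn_trans lt_ij lt_jk);
    by rewrite eq_i ltnn.
have subD e : hasse P :\ e \subset hasse P by apply: subD1set.
have ->: T2_rel3 P i j k = (i, j) |: (hasse P :\ (i, k)).
  apply/setP => -[x y]; rewrite /T2_rel3 !in_setU in_setD !in_set2 !in_set1 in_setD1.
  have [eq_xy|_] := eqVneq (x, y) (j, k); last by rewrite orbF orbC.
  rewrite eq_xy Rjk orbT andbT (_ : (j, k) != (i, k)) ?orbT //.
  by apply/eqP=> -[eq_ji]; rewrite eq_ji ltnn in lt_ij.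
have acD e := acyclic_hasse (subD e).
by rewrite acD !acyclic_add ?nji.
Qed.

End Orders.

(* Isoclasses of special posets: the second order being total, its [n] elements
   are numbered increasingly by ['I_n], the second order becoming the order of
   ['I_n]; an isomorphism is then an equality of first orders. *)
Definition special_poset := {n : nat & partial_order n}.

HB.instance Definition _ := Choice.on special_poset.

Definition SPoset n (P : partial_order n) : special_poset :=
  Tagged partial_order P.

Definition le1 (P : special_poset) : rel 'I_(tag P) := ole (tagged P).
Arguments le1 : clear implicits.

Definition is_heap (P : special_poset) : bool :=
  [forall x, forall y, le1 P x y ==> (x <= y)%N].

Definition is_forest (P : special_poset) : bool :=
  [forall x, forall y, forall z,
    le1 P y x && le1 P z x ==> le1 P y z || le1 P z y].

Definition is_hof (P : special_poset) : bool := is_forest P && is_heap P.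

Definition sp_empty : special_poset := SPoset (discrete 0).

Definition prod_set m n (P : partial_order m) (Q : partial_order n) :
    {set 'I_(m + n) * 'I_(m + n)} :=
  [set p | match split p.1, split p.2 with
           | inl x, inl y => ole P x y
           | inr x, inr y => ole Q x y
           | _, _ => false
           end].

Lemma prod_is_order m n (P : partial_order m) (Q : partial_order n) :
  is_order (prod_set P Q).
Proof.
have [Pr Pa Pt] := oleP P; have [Qr Qa Qt] := oleP Q.
apply/is_orderP; split=> [x|x y|y x z]; rewrite !inE /=.
- by case: (split x).
- move=> xy yx; apply: (can_inj (@splitK m n)); move: xy yx.
  case: (split x) (split y) => a [] b //= ab ba; congr (_ _).
    by apply: Pa; rewrite ab.
  by apply: Qa; rewrite ab.
- case: (split x) (split y) (split z) => a [] b [] c //=.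
    exact: Pt.
  exact: Qt.
Qed.

Definition sp_mul (P Q : special_poset) : special_poset :=
  SPoset (PartialOrder (prod_is_order (tagged P) (tagged Q))).

(* [enum_val] is the increasing bijection from ['I_#|A|] to [A]. *)
Definition restr_set n (P : partial_order n) (A : {set 'I_n}) :
    {set 'I_#|A| * 'I_#|A|} :=
  [set p | ole P (enum_val p.1) (enum_val p.2)].

Lemma restr_is_order n (P : partial_order n) (A : {set 'I_n}) :
  is_order (restr_set P A).
Proof.
have [Pr Pa Pt] := oleP P.
apply/is_orderP; split=> [x|x y|y x z]; rewrite !inE //=.
- by move=> xy yx; apply/enum_val_inj/Pa; rewrite xy.
- exact: Pt.
Qed.

Definition sp_restr (P : special_poset) (A : {set 'I_(tag P)}) :
    special_poset :=
  SPoset (PartialOrder (restr_is_order (tagged P) A)).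

Definition is_ideal (P : special_poset) (I : {set 'I_(tag P)}) : bool :=
  [forall x in I, forall y, le1 P x y ==> (y \in I)].

Arguments sp_restr : clear implicits.
Arguments is_ideal : clear implicits.

Definition pairing_num (P Q : special_poset) : nat :=
  #|[set s : {ffun 'I_(tag P) -> 'I_(tag Q)} |
     [&& injectiveb s, [forall y, y \in codom s],
         [forall i, forall j, le1 P i j ==> (s i <= s j)%N] &
         [forall i, forall j, le1 Q (s i) (s j) ==> (i <= j)%N]]]|.

Record hof := Hof { hof_val : special_poset; _ : is_hof hof_val }.

HB.instance Definition _ := [isSub for hof_val].
HB.instance Definition _ := [Choice of hof by <:].

Lemma enum_val_le n (A : {set 'I_n}) (i j : 'I_#|A|) :
  (enum_val i <= enum_val j)%N = (i <= j)%N.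
Proof.
pose s := [seq val x | x <- enum A].
have srt : sorted ltn s.
  rewrite /s; have -> : enum A = [seq x <- enum 'I_n | x \in A].
    by rewrite {1}/enum_mem -enumT.
  apply: (subseq_sorted ltn_trans (map_subseq _ (filter_subseq _ _))).
  by rewrite val_enum_ord iota_ltn_sorted.
have sz : size s = #|A| by rewrite size_map cardE.
have E (k : 'I_#|A|) : val (enum_val k) = nth 0%N s k.
  by rewrite (nth_map (enum_val k)) -?cardE //; congr val; apply: enum_val_nth.
have mono (k l : 'I_#|A|) : (k < l)%N -> (enum_val k < enum_val l)%N.
  by move=> kl; rewrite !E (sorted_ltn_nth ltn_trans) // inE sz.
case: (ltngtP i j) => [/mono/ltnW//|/mono|/val_inj->]; last exact: leqnn.
by rewrite ltnNge => /negPf.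
Qed.

Lemma sp_empty_hof : is_hof sp_empty.
Proof. by apply/andP; split; apply/forallP => -[]. Qed.

Lemma sp_mul_hof (P Q : special_poset) :
  is_hof P -> is_hof Q -> is_hof (sp_mul P Q).
Proof.
case/andP=> /forallP fP /forallP hP /andP[/forallP fQ /forallP hQ].
apply/andP; split; apply/forallP => x; apply/forallP => y.
- apply/forallP => z; rewrite /le1 /ole /= !inE /=.
  case: (split x) (split y) (split z) => a [] b [] c; rewrite ?andbF //=.
    by have /forallP/(_ b)/forallP/(_ c) := fP a.
  by have /forallP/(_ b)/forallP/(_ c) := fQ a.
- rewrite /le1 /ole /= !inE /=; apply/implyP.
  rewrite -[X in (nat_of_ord X <= _)%N](splitK x).
  rewrite -[X in (_ <= nat_of_ord X)%N](splitK y).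
  case: (split x) (split y) => a [] b //= ab.
    by have /forallP/(_ b)/implyP/(_ ab) := hP a.
  by have /forallP/(_ b)/implyP/(_ ab) := hQ a; rewrite leq_add2l.
Qed.

Lemma sp_restr_hof (P : special_poset) (A : {set 'I_(tag P)}) :
  is_hof P -> is_hof (sp_restr P A).
Proof.
case/andP=> /forallP fP /forallP hP.
apply/andP; split; apply/forallP => x; apply/forallP => y.
- apply/forallP => z; rewrite /le1 /ole /= !inE /=.
  by have /forallP/(_ (enum_val y))/forallP/(_ (enum_val z)) := fP (enum_val x).
- rewrite /le1 /ole /= !inE /= -enum_val_le.
  by have /forallP/(_ (enum_val y)) := hP (enum_val x).
Qed.

Definition hof_empty : hof := Hof sp_empty_hof.

Definition hof_mul (P Q : hof) : hof := Hof (sp_mul_hof (valP P) (valP Q)).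

Definition hof_restr (P : hof) (A : {set 'I_(tag (hof_val P))}) : hof :=
  Hof (sp_restr_hof A (valP P)).

Arguments hof_restr : clear implicits.

(* Letters and positions are numbered from 0. *)
Definition permutation := {n : nat & 'S_n}.

HB.instance Definition _ := Choice.on permutation.

Definition Permutation n (s : 'S_n) : permutation :=
  Tagged (fun n => 'S_n) s.

Definition word n (s : 'S_n) : seq nat := [seq val (s i) | i <- enum 'I_n].

Fixpoint shuffle (u : seq nat) : seq nat -> seq (seq nat) :=
  match u with
  | [::] => fun v => [:: v]
  | a :: u' =>
      fix shuffle_u v :=
        match v with
        | [::] => [:: u]
        | b :: v' => [seq a :: w | w <- shuffle u' v] ++
                     [seq b :: w | w <- shuffle_u v']
        end
  end.

Section Standardization.
Variable w : seq nat.

(* Standardization of an arbitrary word; equal letters are ordered from left to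
   right, which is irrelevant for the words considered here. *)
Definition std_lt (i j : 'I_(size w)) : bool :=
  (nth 0 w i < nth 0 w j)%N || (nth 0 w i == nth 0 w j) && (i < j)%N.

Lemma std_rank_lt (i : 'I_(size w)) : (#|[set j | std_lt j i]| < size w)%N.
Proof.
rewrite -[X in (_ < X)%N]card_ord; apply/proper_card/properP; split.
  exact/subsetP.
by exists i; rewrite // inE /std_lt !ltnn andbF.
Qed.

Definition std_fun (i : 'I_(size w)) : 'I_(size w) := Ordinal (std_rank_lt i).

Lemma std_fun_inj : injective std_fun.
Proof.
have mono i j : std_lt i j -> (std_fun i < std_fun j)%N.
  move=> lt_ij; apply/proper_card/properP; split.
    apply/subsetP => k; rewrite !inE; move: lt_ij; rewrite /std_lt.
    case/orP=> [ij|/andP[/eqP<- ij]] /orP[ki|/andP[/eqP-> ki]].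
    - by rewrite (ltn_trans ki ij).
    - by rewrite ij.
    - by rewrite ki.
    - by rewrite eqxx (ltn_trans ki ij) orbT.
  by exists i; rewrite !inE // /std_lt !ltnn andbF.
move=> i j eq_ij; apply/eqP; apply: contraT => neq_ij.
have /orP[/mono|/mono] : std_lt i j || std_lt j i; last 2 first.
- by rewrite eq_ij ltnn.
- by rewrite eq_ij ltnn.
rewrite /std_lt; case: (ltngtP (nth _ _ _)) => //= _.
by rewrite -neq_ltn; exact: neq_ij.
Qed.

Definition standardization : 'S_(size w) := perm std_fun_inj.

End Standardization.

Definition is_linear_extension (P : special_poset) (s : 'S_(tag P)) : bool :=
  [forall i, forall j, (i != j) && le1 P i j ==>
     ((s^-1)%g i < (s^-1)%g j)%N].

Arguments is_linear_extension : clear implicits.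

Section HopfAlgebras.
Variable K : fieldType.

Definition HSP : based_hopf K := {|
  hbasis := special_poset;
  hone1 := sp_empty;
  hmul1 := fun P Q => << sp_mul P Q >>;
  hcounit1 := fun P => (tag P == 0%N)%:R;
  hcomul1 := fun P =>
    \sum_(I | is_ideal P I) << (sp_restr P (~: I), sp_restr P I) >>
|}.

Definition HHOF : based_hopf K := {|
  hbasis := hof;
  hone1 := hof_empty;
  hmul1 := fun P Q => << hof_mul P Q >>;
  hcounit1 := fun P => (tag (hof_val P) == 0%N)%:R;
  hcomul1 := fun P =>
    \sum_(I | is_ideal (hof_val P) I)
      << (hof_restr P (~: I), hof_restr P I) >>
|}.

Definition FQSym : based_hopf K := {|
  hbasis := permutation;
  hone1 := Permutation (1%g : 'S_0);
  hmul1 := fun s t =>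
    let k := tag s in
    \sum_(r : 'S_(k + tag t) |
        word r \in shuffle (word (tagged s))
                           [seq (k + a)%N | a <- word (tagged t)])
      << Permutation r >>;
  hcounit1 := fun s => (tag s == 0%N)%:R;
  hcomul1 := fun s =>
    let w := word (tagged s) in
    \sum_(k < (tag s).+1)
      << (Permutation (standardization (take k w)),
          Permutation (standardization (drop k w))) >>
|}.

Definition hof_incl : {linear hspace HHOF -> hspace HSP} :=
  linext (fun P : hof => << hof_val P >> : hspace HSP).

Definition Theta : {linear hspace HSP -> hspace FQSym} :=
  linext (fun P : special_poset =>
    (\sum_(s | is_linear_extension P s) << Permutation s >> : hspace FQSym)).

Definition Theta_hof : {linear hspace HHOF -> hspace FQSym} :=
  (Theta \o hof_incl)%FUN.

Definition pairing (x y : hspace HSP) : K :=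
  \sum_(P <- msupp x) \sum_(Q <- msupp y) x@_P * y@_Q * (pairing_num P Q)%:R.

Inductive transformation : special_poset -> hspace HSP -> Prop :=
| T1 n (P : partial_order n) (i j : 'I_n) of T1_applicable P i j :
    transformation (SPoset P)
      (<< SPoset (generated (T1_rel1 P i j)) >>
       - << SPoset (generated (T1_rel2 P i j)) >>)
| T2 n (P : partial_order n) (i j k : 'I_n) of T2_applicable P i j k :
    transformation (SPoset P)
      (<< SPoset (generated (T2_rel1 P i j k)) >>
       - << SPoset (generated (T2_rel2 P i j k)) >>
       + << SPoset (generated (T2_rel3 P i j k)) >>).

Inductive step : hspace HSP -> hspace HSP -> Prop :=
| Step (x y : hspace HSP) (Q : special_poset) of
    x@_Q != 0 & transformation Q y :
    step x (x - x@_Q *: << Q >> + x@_Q *: y).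

Inductive steps : hspace HSP -> hspace HSP -> Prop :=
| StepsNil x : steps x x
| StepsCons x y z of step x y & steps y z : steps x z.

End HopfAlgebras.

(* Main.v *)
From mathcomp Require Import all_boot all_order all_algebra all_fingroup.
From mathcomp Require Import finmap.
From mathcomp.multinomials Require Import monalg.
Require Import Defs.

Set Implicit Arguments.
Unset Strict Implicit.
Unset Printing Implicit Defensive.

Import GRing.Theory.
Local Open Scope ring_scope.

(** Write Theta(P) for the sum of the linear extensions of P.  Everything follows
    from the behaviour of Theta, of which Upsilon is the lift to forests.

    _Invariance._  If an acyclic relation R generates the first order of P, the
    linear extensions of P are the total orders that respect R.  In (T1), the
    total orders that respect [hasse Q] without the edge (j, i) are sorted by
    which of i and j comes first: those with j first are the linear extensions
    of Q, the others those of the subtracted term.  In (T2) one sorts in the same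
    way by the relative positions of i, j and k.  Hence a step does not change
    Theta ([Theta_steps]).

    _Termination._  Give an edge (a, b) of a Hasse diagram the weight b + 1 if
    a < b, and a weight larger than all of these otherwise.  Both
    transformations delete an edge or trade it for a lighter one
    ([weight_generated]), so every strategy that rewrites posets that are not
    heap-ordered forests ends, and it ends on heap-ordered forests because a
    poset without descending edge and without vertex covering two others is one
    ([normal_form]).

    _Injectivity on forests._  In a heap-ordered forest the largest label b is a
    leaf.  Take a total order of the other labels and insert b immediately after
    a label a, then immediately before it: one of the results is a linear
    extension and the other is not precisely when a is the parent of b and the
    order of the other labels is a linear extension of the rest.  Taking the difference of two
    coefficients of Theta(x) thus extracts the part of x supported by the forests
    in which b has parent a; going down through the labels isolates a single
    forest ([sum_same_parents], [Theta_hof_inj]).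

    By invariance and injectivity, the normal form Upsilon(P) is unique and
    Theta o Upsilon = Theta.  A chain has a single linear extension, so
    Theta(Upsilon(chain)) runs over the basis of FQSym: Theta is bijective on
    forests.  Finally Theta is a morphism of Hopf algebras: a linear extension of
    a disjoint union is a shuffle ([Theta_mul]), and cutting a linear extension in
    two is the same as choosing an ideal and linear extensions of it and of its
    complement ([Theta_comul]).  Being the composite of Theta with the inverse of
    the isomorphism it induces on forests, Upsilon is a morphism as well.  The
    pairing of P and Q counts the permutations t such that t is a linear extension
    of Q and its inverse one of P; it factors through Theta ([pairing_Theta]),
    hence is preserved by Upsilon. *)

(** * Linear and bilinear maps out of free spaces *)

Section FreeSpaceTheory.
Variable K : fieldType.

Lemma linextU (B : choiceType) (V : lmodType K) (f : B -> V) (b : B) :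
  linext f << b >> = f b.
Proof. by rewrite /linext msuppU oner_eq0 big_seq_fset1 mcoeffUU scale1r. Qed.

Lemma malg_sumZ (B : choiceType) (x : {malg K[B]}) :
  x = \sum_(b <- msupp x) x@_b *: << b >>.
Proof.
rewrite {1}[x]monalgE; apply: eq_bigr => b _; apply/malgP => c.
by rewrite mcoeffZ !mcoeffU mulr_natr.
Qed.

Lemma linear_ext (B : choiceType) (V : lmodType K)
    (f g : {linear {malg K[B]} -> V}) :
  (forall b, f << b >> = g << b >>) -> f =1 g.
Proof.
move=> fg x; rewrite (malg_sumZ x) !linear_sum; apply: eq_bigr => b _.
by rewrite !linearZ /= fg.
Qed.

Lemma linextE (B : choiceType) (V : lmodType K) (f g : B -> V) x :
  f =1 g -> linext f x = linext g x.
Proof. by move=> fg; apply: eq_bigr => b _; rewrite fg. Qed.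

Lemma linext_comp (B : choiceType) (V W : lmodType K)
    (g : {linear V -> W}) (f : B -> V) x :
  g (linext f x) = linext (g \o f) x.
Proof. by rewrite /linext linear_sum; apply: eq_bigr => b _; rewrite linearZ. Qed.

Section Bilinear.
Variables (A B : choiceType) (V : lmodType K).

Definition bilext (f : A -> B -> V) (x : {malg K[A]}) (y : {malg K[B]}) : V :=
  linext (fun a => linext (f a) y) x.

Lemma bilextE f x y : bilext f x y =
  \sum_(a <- msupp x) \sum_(b <- msupp y) (x@_a * y@_b) *: f a b.
Proof.
apply: eq_bigr => a _; rewrite scaler_sumr; apply: eq_bigr => b _.
by rewrite scalerA.
Qed.

Lemma bilextC f x y : bilext f x y = linext (fun b => linext (f^~ b) x) y.
Proof.
rewrite bilextE exchange_big; apply: eq_bigr => b _ /=.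
by rewrite scaler_sumr; apply: eq_bigr => a _; rewrite scalerA mulrC.
Qed.

Lemma bilextZl f c x y : bilext f (c *: x) y = c *: bilext f x y.
Proof. by rewrite /bilext linearZ. Qed.

Lemma bilextZr f c x y : bilext f x (c *: y) = c *: bilext f x y.
Proof. by rewrite !bilextC linearZ. Qed.

Lemma bilextUU f a b : bilext f << a >> << b >> = f a b.
Proof. by rewrite /bilext !linextU. Qed.

Lemma bilext_suml f y (I : Type) (r : seq I) (P : pred I) F :
  bilext f (\sum_(i <- r | P i) F i) y = \sum_(i <- r | P i) bilext f (F i) y.
Proof. by rewrite /bilext linear_sum. Qed.

Lemma bilext_sumr f x (I : Type) (r : seq I) (P : pred I) F :
  bilext f x (\sum_(i <- r | P i) F i) = \sum_(i <- r | P i) bilext f x (F i).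
Proof. by rewrite bilextC linear_sum; apply: eq_bigr => i _; rewrite bilextC. Qed.

End Bilinear.

(** Naturality of bilinear extension, checked on bases.  It gives at once the
    compatibility of a map with products, of [tensmap] with tensors, and of a
    bilinear form with a change of spaces. *)
Lemma bilext_comp (A B A' B' : choiceType) (V W : lmodType K)
    (f : A -> B -> V) (f' : A' -> B' -> W)
    (u : {linear {malg K[A]} -> {malg K[A']}})
    (v : {linear {malg K[B]} -> {malg K[B']}}) (w : {linear V -> W}) :
  (forall a b, w (f a b) = bilext f' (u << a >>) (v << b >>)) ->
  forall x y, w (bilext f x y) = bilext f' (u x) (v y).
Proof.
move=> wf x y; rewrite {2}(malg_sumZ x) {2}(malg_sumZ y) bilextE !linear_sum.
rewrite bilext_suml; apply: eq_bigr => a _; rewrite linear_sum bilext_sumr.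
apply: eq_bigr => b _; rewrite !linearZ /= wf -scalerA.
by rewrite bilextZl bilextZr.
Qed.

End FreeSpaceTheory.

(** * Morphisms of Hopf algebras *)

Section HopfMorphismTheory.
Variable K : fieldType.

Lemma tensmap_tens (A B : choiceType) (f : {linear {malg K[A]} -> {malg K[B]}}) x y :
  tensmap f (tens x y) = tens (f x) (f y).
Proof.
apply: (bilext_comp (u := f) (v := f)
  (w := linext (fun p : A * A => tens (f << p.1 >>) (f << p.2 >>)))) => a b.
exact: linextU.
Qed.

Lemma tensmap_comp (A B C : choiceType) (f : {linear {malg K[A]} -> {malg K[B]}})
    (g : {linear {malg K[B]} -> {malg K[C]}}) z :
  tensmap g (tensmap f z) = tensmap (g \o f) z.
Proof.
rewrite [LHS](linext_comp (linext _)); apply: linextE => -[a b].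
exact: tensmap_tens.
Qed.

Lemma eq_tensmap (A B : choiceType) (f g : {malg K[A]} -> {malg K[B]}) z :
  f =1 g -> tensmap f z = tensmap g z.
Proof. by move=> fg; apply: linextE => p; rewrite !fg. Qed.

Lemma tensmap_id (A : choiceType) (f : {malg K[A]} -> {malg K[A]}) z :
  f =1 id -> tensmap f z = z.
Proof.
move=> fK; rewrite {2}(malg_sumZ z); apply: eq_bigr => -[a b] _ /=.
by rewrite !fK /tens !linextU.
Qed.

Lemma hopf_morphism_basis (A B : based_hopf K)
    (f : {linear hspace A -> hspace B}) :
  f (hone A) = hone B ->
  (forall a b, f (hmul1 a b) = hmul (f << a >>) (f << b >>)) ->
  (forall a, hcounit (f << a >>) = hcounit1 a) ->
  (forall a, hcomul (f << a >>) = tensmap f (hcomul1 a)) ->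
  hopf_morphism f.
Proof.
move=> f1 fM fe fD; split=> //.
- move=> x y; exact: (bilext_comp (u := f) (v := f) (w := f) fM).
- apply: (linear_ext (f := (linext _ \o f)%FUN) (g := linext _)) => a /=.
  by rewrite linextU; apply: fe.
- apply: (linear_ext (f := (linext _ \o f)%FUN)
                     (g := (linext _ \o linext _)%FUN)) => a /=.
  by rewrite linextU; apply: fD.
Qed.

Lemma hopf_morphism_comp (A B C : based_hopf K)
    (f : {linear hspace A -> hspace B}) (g : {linear hspace B -> hspace C}) :
  hopf_morphism f -> hopf_morphism g -> hopf_morphism (g \o f)%FUN.
Proof.
case=> f1 fM fe fD [g1 gM ge gD]; split=> [|x y|x|x] /=.
- by rewrite f1.
- by rewrite fM gM.
- by rewrite ge fe.
- by rewrite gD fD tensmap_comp.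
Qed.

(** A factorization of a morphism [h] through an injective morphism [g] is a
    morphism.  The left inverse [g'] serves for the coproduct: it makes the tensor
    square of [g] injective too. *)
Lemma hopf_morphism_lift (A B C : based_hopf K)
    (f : {linear hspace A -> hspace B}) (g : {linear hspace B -> hspace C})
    (h : {linear hspace A -> hspace C}) (g' : {linear hspace C -> hspace B}) :
  cancel g g' -> hopf_morphism g -> hopf_morphism h -> g \o f =1 h ->
  hopf_morphism f.
Proof.
move=> gK [g1 gM ge gD] [h1 hM he hD] gf; have inj_g := can_inj gK.
have gfE x : g (f x) = h x := gf x.
split=> [|x y|x|x].
- by apply: inj_g; rewrite gfE h1 g1.
- by apply: inj_g; rewrite gM !gfE hM.
- by rewrite -ge gfE he.
- rewrite -[LHS](tensmap_id (f := g' \o g) _ gK) -tensmap_comp -gD gfE hD.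
  rewrite -(eq_tensmap _ gf) -tensmap_comp tensmap_comp.
  by rewrite (tensmap_id _ gK).
Qed.

End HopfMorphismTheory.

(** * Hasse diagrams and the orders that respect them *)

Section HasseDiagrams.
Variable n : nat.
Implicit Types (R : {set 'I_n * 'I_n}) (P : partial_order n).

Local Notation conn R := (connect [rel x y : 'I_n | (x, y) \in R]).

(** The first order is the closure of its covering relation: an interval that
    is not an edge has an interior point, which splits it into smaller
    intervals. *)
Lemma ole_hasse P x y : ole P x y = conn (hasse P) x y.
Proof.
have [le_refl le_anti le_tr] := oleP P.
apply/idP/idP; last exact: connect_hasse.
pose I x y := [set c | ole P x c && ole P c y].
have [m] := ubnP #|I x y|; elim: m x y => // m IHm x y; rewrite ltnS => le_I xy.
have [->|neq_xy] := eqVneq x y; first exact: connect0.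
have [Rxy|] := boolP ((x, y) \in hasse P); first exact: connect1.
rewrite inE /= neq_xy /= -/(I x y) eqEsubset negb_and orbC.
have -> /= : [set x; y] \subset I x y.
  by apply/subsetP=> c; rewrite !inE => /orP[]/eqP->; rewrite ?le_refl ?xy.
case/subsetPn=> c; rewrite !inE => /andP[xc cy] /norP[neq_cx neq_cy].
apply: (connect_trans (y := c)); apply: IHm => //;
  apply: leq_trans le_I; apply/proper_card/properP; split.
- by apply/subsetP=> d; rewrite !inE => /andP[-> /le_tr->].
- exists y; rewrite !inE ?xy ?le_refl //=; apply: contra neq_cy => yc.
  by apply/eqP/le_anti; rewrite cy.
- by apply/subsetP=> d; rewrite !inE => /andP[/(le_tr _ _ _ xc)-> ->].
- exists x; rewrite !inE ?xy ?le_refl //= andbT; apply: contra neq_cx => cx.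
  by apply/eqP/le_anti; rewrite cx.
Qed.

Lemma ole_generated R x y : acyclic R -> ole (generated R) x y = conn R x y.
Proof. by move=> acR; rewrite /ole generatedE // inE. Qed.

(** A covering pair cannot be reached by a path of [R] of length two or more, as
    an intermediate vertex would lie strictly between its ends. *)
Lemma hasse_generated R : acyclic R -> hasse (generated R) \subset R.
Proof.
move=> acR; apply/subsetP => -[a b] /hasseP[]; rewrite ole_generated //.
case/connectP=> -[|c p] /=; first by move=> _ ->; rewrite eqxx.
case/andP=> Rac pP b_last _ /(_ c); rewrite !ole_generated //.
rewrite (connect1 Rac) => /(_ isT) [|eq_ca|<-] //.
  by apply/connectP; exists p.
by have /acyclicP/(_ _ _ Rac) := acR; rewrite eq_ca connect0.
Qed.

Definition respects R (pos : 'I_n -> nat) : bool :=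
  [forall e in R, pos e.1 < pos e.2]%N.

Lemma respectsP R pos :
  reflect (forall x y, (x, y) \in R -> (pos x < pos y)%N) (respects R pos).
Proof. by apply: (iffP forall_inP) => [H x y /H //|H [x y] /H]. Qed.

Lemma eq_respects R pos pos' : pos =1 pos' -> respects R pos = respects R pos'.
Proof. by move=> eq_pos; apply: eq_forallb => e; rewrite !eq_pos. Qed.

Lemma respectsU R R' pos :
  respects (R :|: R') pos = respects R pos && respects R' pos.
Proof.
apply/respectsP/andP=> [H|[/respectsP H /respectsP H'] x y].
  by split; apply/respectsP => x y xy; apply: H; rewrite inE xy ?orbT.
by rewrite inE => /orP[/H|/H'].
Qed.

Lemma respects1 i j pos : respects [set (i, j)] pos = (pos i < pos j)%N.
Proof.
apply/respectsP/idP => [->|ij x y]; rewrite ?inE //.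
by move=> /eqP[-> ->].
Qed.

Lemma respects_connect R pos x y :
  respects R pos -> conn R x y -> (pos x <= pos y)%N.
Proof.
move=> /respectsP Rpos /connectP[p]; elim: p x => [|z p IHp] x /=.
  by move=> _ ->.
by case/andP=> /Rpos/ltnW xz pP y_last; apply: leq_trans xz (IHp _ pP y_last).
Qed.

Lemma respects_closure R P pos : injective pos ->
    (forall x y, ole P x y = conn R x y) ->
    (forall x y, (x, y) \in R -> x != y) ->
  respects R pos = [forall x, forall y, (x != y) && ole P x y ==> (pos x < pos y)%N].
Proof.
move=> inj_pos PE Rneq; apply/idP/idP => [Rpos|/forallP H].
  apply/forallP=> x; apply/forallP=> y; apply/implyP; rewrite PE => /andP[neq_xy].
  move/(respects_connect Rpos); rewrite leq_eqVlt => /orP[/eqP/inj_pos eq_xy|//].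
  by rewrite eq_xy eqxx in neq_xy.
apply/respectsP=> x y Rxy; have /forallP/(_ y)/implyP := H x; apply.
by rewrite (Rneq _ _ Rxy) PE connect1.
Qed.

Lemma inv_perm_inj (s : 'S_n) : injective (fun i => val ((s^-1)%g i)).
Proof. by move=> i j /val_inj/perm_inj. Qed.

Lemma linear_extension_hasse P s :
  is_linear_extension (SPoset P) s = respects (hasse P) (fun i => (s^-1)%g i).
Proof.
symmetry; apply: respects_closure => [|x y|x y /hasseP[]] //.
  exact: inv_perm_inj.
exact: ole_hasse.
Qed.

Lemma linear_extension_generated R s : acyclic R ->
  is_linear_extension (SPoset (generated R)) s
    = respects R (fun i => (s^-1)%g i).
Proof.
move=> acR; symmetry; apply: respects_closure => [|x y|x y Rxy].
- exact: inv_perm_inj.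
- exact: ole_generated.
- by apply: contraTneq acR => eq_xy; apply/negP => /acyclicP/(_ _ _ Rxy);
    rewrite eq_xy connect0.
Qed.

(** Descending edges get a weight above all ascending ones, so that reversing a
    descending edge as in (T1) lowers the weight; among ascending edges the weight
    grows with the upper end, so that trading (j, k) or (i, k) for (i, j) as in
    (T2), where i < j < k, lowers it too. *)
Definition edge_weight (e : 'I_n * 'I_n) : nat :=
  if (e.1 < e.2)%N then e.2.+1 else n.+1.

Definition weight P : nat := (\sum_(e in hasse P) edge_weight e)%N.

(** The relations [R] used by the transformations are, up to inclusion, obtained
    by trading an edge [e] for a lighter one [f]; inclusion suffices because the
    covering pairs of the new order are among [R]. *)
Lemma weight_generated P R e f : acyclic R -> e \in hasse P ->
    R \subset f |: (hasse P :\ e) -> (edge_weight f < edge_weight e)%N ->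
  (weight (generated R) < weight P)%N.
Proof.
move=> acR Re sRP lt_fe; rewrite [X in (_ < X)%N](big_setD1 e) //=.
have sumS (A B : {set 'I_n * 'I_n}) : A \subset B ->
    (\sum_(d in A) edge_weight d <= \sum_(d in B) edge_weight d)%N.
  move=> sAB; rewrite [X in (_ <= X)%N](big_setID A) /=.
  by rewrite (setIidPr sAB) leq_addr.
apply: (@leq_ltn_trans (edge_weight f + \sum_(d in hasse P :\ e) edge_weight d)%N).
  apply: leq_trans (sumS _ _ (subset_trans (hasse_generated acR) sRP)) _.
  have [f_in|notin_f] := boolP (f \in hasse P :\ e); last by rewrite big_setU1.
  by rewrite (setUidPr _) ?sub1set // leq_addl.
by rewrite ltn_add2r.
Qed.

End HasseDiagrams.

(** * Termination of the transformations *)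

Section NormalForms.

Section Reducibility.
Variable n : nat.
Implicit Types (P : partial_order n).

Lemma heap_hasse P : (forall i j, (i, j) \in hasse P -> (i < j)%N) ->
  is_heap (SPoset P).
Proof.
move=> up; apply/forallP=> x; apply/forallP=> y; apply/implyP.
rewrite /le1 /= ole_hasse; apply: (@respects_connect _ _ val).
exact/respectsP.
Qed.

Lemma ole_last_edge P x y : ole P x y -> x != y ->
  exists2 z, ole P x z & (z, y) \in hasse P.
Proof.
rewrite ole_hasse => /connectP[p]; elim/last_ind: p => [|p z _] /=.
  by move=> _ -> /eqP.
rewrite rcons_path last_rcons => /andP[pP zy] -> _; exists (last x p) => //.
by rewrite ole_hasse; apply/connectP; exists p.
Qed.

(** If each vertex covers at most one other, two elements below [x] are either
    equal to [x] or both below the vertex that [x] covers; conclude by induction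
    on [x]. *)
Lemma forest_hasse P : (forall i j, (i, j) \in hasse P -> (i < j)%N) ->
    (forall i j k, (i, k) \in hasse P -> (j, k) \in hasse P -> i = j) ->
  is_forest (SPoset P).
Proof.
move=> up par; apply/forallP=> x; apply/forallP=> y; apply/forallP=> z.
rewrite /le1 /=; apply/implyP => /andP[].
have [m] := ubnP x; elim: m x => // m IHm x; rewrite ltnS => le_xm yx zx.
have [->|neq_yx] := eqVneq y x; first by rewrite zx orbT.
have [->|neq_zx] := eqVneq z x; first by rewrite yx.
have [p yp px] := ole_last_edge yx neq_yx.
have [q zq qx] := ole_last_edge zx neq_zx.
rewrite -(par _ _ _ px qx) in zq; apply: IHm yp zq.
exact: leq_trans (up _ _ px) le_xm.
Qed.

End Reducibility.

Variable K : fieldType.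

(** A descending edge allows (T1).  Without one the order is heap-ordered, and
    then a vertex covering two others allows (T2). *)
Lemma not_hof_transformation (Q : special_poset) :
  ~~ is_hof Q -> {y : hspace (HSP K) | transformation Q y}.
Proof.
case: Q => n P nhP; have [[i j] ijP|no1] := pickP (fun e => T1_applicable P e.1 e.2).
  by eexists; apply: (T1 K ijP).
have [[[i j] k] ijkP|no2] := pickP (fun e => T2_applicable P e.1.1 e.1.2 e.2).
  by eexists; apply: (T2 K ijkP).
have up i j : (i, j) \in hasse P -> (i < j)%N.
  move=> Rij; have [_ neq_ij _] := hasseP Rij.
  have := no1 (j, i); rewrite /T1_applicable /= Rij andbT.
  by case: ltngtP neq_ij => // /val_inj->; rewrite eqxx.
case/negP: nhP; rewrite /is_hof (heap_hasse up) (forest_hasse up) // => i j k Rik Rjk.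
have := no2 (i, j, k); rewrite /T2_applicable /= Rik Rjk (up _ _ Rjk) /= andbT.
have := no2 (j, i, k); rewrite /T2_applicable /= Rik Rjk (up _ _ Rik) /= andbT.
by case: ltngtP => // /val_inj->.
Qed.

Definition sp_weight (P : special_poset) : nat := weight (tagged P).

(** Read in this way, the last term of (T2) also trades a single edge. *)
Lemma T2_rel3E n (P : partial_order n) i j k : T2_applicable P i j k ->
  T2_rel3 P i j k = (i, j) |: (hasse P :\ (i, k)).
Proof.
case/and4P=> lt_ij _ _ Rjk; apply/setP => -[x y].
rewrite /T2_rel3 !in_setU in_setD !in_set2 !in_set1 in_setD1.
have [eq_xy|_] := eqVneq (x, y) (j, k); last by rewrite orbF orbC.
rewrite eq_xy Rjk orbT andbT (_ : (j, k) != (i, k)) ?orbT //.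
by apply/eqP=> -[eq_ji]; rewrite eq_ji ltnn in lt_ij.
Qed.

Lemma msupp_basis (B : choiceType) (a b : B) :
  a \in msupp (<< b >> : {malg K[B]}) -> a = b.
Proof. by rewrite msuppU oner_eq0 in_fset1 => /eqP. Qed.

Lemma transformation_msupp (Q : special_poset) (y : hspace (HSP K)) :
  transformation Q y ->
  exists P1 P2 P3 : special_poset,
    [/\ (sp_weight P1 < sp_weight Q)%N, (sp_weight P2 < sp_weight Q)%N,
        (sp_weight P3 < sp_weight Q)%N &
        forall P, P \in msupp y -> [\/ P = P1, P = P2 | P = P3]].
Proof.
case=> [n P i j Hij|n P i j k Hijk].
- have [/andP[lt_ij Rji] /andP[ac1 ac2]] := (Hij, T1_acyclic Hij).
  have lt_w : (edge_weight (i, j) < edge_weight (j, i))%N.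
    by rewrite /edge_weight /= lt_ij [(j < i)%N]ltnNge (ltnW lt_ij) ltnS ltn_ord.
  exists (SPoset (generated (T1_rel1 P i j))), (SPoset (generated (T1_rel2 P i j))),
    (SPoset (generated (T1_rel1 P i j))).
  split; try by apply: (weight_generated _ Rji _ lt_w) => //; apply: subsetUr.
  move=> P' /(fsubsetP (msuppB_le _ _)); rewrite in_fsetU.
  by case/orP=> /msupp_basis; [constructor 1|constructor 2].
- have [/and4P[lt_ij lt_jk Rik Rjk] /and3P[ac1 ac2 ac3]] := (Hijk, T2_acyclic Hijk).
  have lt_ik := ltn_trans lt_ij lt_jk.
  have lt_w : (edge_weight (i, j) < edge_weight (j, k))%N.
    by rewrite /edge_weight /= lt_ij lt_jk.
  have lt_w' : (edge_weight (i, j) < edge_weight (i, k))%N.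
    by rewrite /edge_weight /= lt_ij lt_ik.
  exists (SPoset (generated (T2_rel1 P i j k))),
    (SPoset (generated (T2_rel2 P i j k))), (SPoset (generated (T2_rel3 P i j k))).
  split.
  + by apply: (weight_generated _ Rjk _ lt_w) => //; apply: subsetUr.
  + exact: (weight_generated _ Rjk _ lt_w).
  + by apply: (weight_generated _ Rik _ lt_w') => //; rewrite T2_rel3E.
  move=> P' /(fsubsetP (msuppD_le _ _)); rewrite in_fsetU.
  case/orP=> [/(fsubsetP (msuppB_le _ _))|/msupp_basis]; last by constructor 3.
  by rewrite in_fsetU; case/orP=> /msupp_basis; [constructor 1|constructor 2].
Qed.

(** A step replaces one poset by at most three of smaller weight, so the sum
    of the numbers 4 ^ weight over the posets that are not forests decreases. *)
Definition defect (P : special_poset) : nat :=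
  (if is_hof P then 0 else 4 ^ sp_weight P)%N.

Definition potential (x : hspace (HSP K)) : nat :=
  (\sum_(P <- msupp x) defect P)%N.

Lemma step_potential (x y : hspace (HSP K)) (Q : special_poset) :
    x@_Q != 0 -> ~~ is_hof Q -> transformation Q y ->
  (potential (x - x@_Q *: << Q >> + x@_Q *: y) < potential x)%N.
Proof.
move=> xQ nhQ /transformation_msupp[P1 [P2 [P3 [lt1 lt2 lt3 yP]]]].
set x' := _ + _; have Qx : Q \in msupp x by rewrite -mcoeff_neq0.
have sub : {subset msupp x' <= (msupp x `\ Q)%fset ++ msupp y}.
  move=> P; rewrite mem_cat in_fsetD1 -!mcoeff_neq0 mcoeffD mcoeffB !mcoeffZ.
  rewrite mcoeffU [Q == P]eq_sym; have [->|_] := eqVneq P Q.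
    by rewrite mulr1 subrr add0r /=; apply: contraNneq => ->; rewrite mulr0.
  rewrite mulr0 subr0 /=; apply: contraNT; rewrite negb_or !negbK.
  by case/andP=> /eqP-> /eqP->; rewrite mulr0 addr0.
rewrite /potential [X in (_ < X)%N](big_fsetD1 Q) //=.
rewrite [X in (_ < X + _)%N]/defect (negPf nhQ).
apply: (@leq_ltn_trans (\sum_(P <- (msupp x `\ Q)%fset ++ msupp y) defect P)%N).
  apply: (@sub_le_big_seq _ addn leq leqnn (fun m n => leq_addr n m)) => P.
  rewrite (count_uniq_mem _ (fset_uniq _)).
  by case: (boolP (_ \in _)) => // /sub; rewrite -has_pred1 has_count.
rewrite big_cat /= addnC ltn_add2r.
rewrite -(ltn_pmul2l (isT : 0 < 4)%N) big_distrr /= -expnS.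
apply: (@leq_ltn_trans (3 * 4 ^ sp_weight Q)%N); last first.
  by rewrite expnS ltn_mul2r expn_gt0.
apply: (@leq_trans (\sum_(P <- msupp y) 4 ^ sp_weight Q)%N); last first.
  rewrite big_const_seq count_predT iter_addn_0 mulnC leq_mul2r; apply/orP; right.
  apply: (@uniq_leq_size _ _ [:: P1; P2; P3]) => [|P]; first exact: fset_uniq.
  by rewrite !inE => /yP[]->; rewrite eqxx ?orbT.
rewrite [X in (X <= _)%N]big_seq [X in (_ <= X)%N]big_seq.
apply: leq_sum => P Py; rewrite /defect; case: ifP => // _.
have lt_PQ : (sp_weight P < sp_weight Q)%N by case: (yP P Py) => ->.
by rewrite -expnS leq_exp2l.
Qed.

Definition hof_part (x : hspace (HSP K)) : hspace (HHOF K) :=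
  linext (fun P => if insub P is Some F then << (F : hof) >> else 0) x.

Lemma hof_partK (x : hspace (HSP K)) :
  (forall P, P \in msupp x -> is_hof P) -> hof_incl K (hof_part x) = x.
Proof.
move=> hx; rewrite {2}(malg_sumZ x) /hof_part linear_sum; apply: eq_big_seq => P.
by move=> /hx hP; rewrite linearZ /= insubT /= linextU.
Qed.

Lemma normal_form (x : hspace (HSP K)) :
  {z : hspace (HHOF K) | steps x (hof_incl K z)}.
Proof.
have [m] := ubnP (potential x); elim: m x => // m IHm x; rewrite ltnS => le_xm.
have [has_nh|all_h] := boolP (has [pred P | ~~ is_hof P] (msupp x)).
  pose Q := nth sp_empty (msupp x) (find [pred P | ~~ is_hof P] (msupp x)).
  have xQ : x@_Q != 0 by rewrite mcoeff_neq0 mem_nth -?has_find.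
  have nhQ : ~~ is_hof Q := nth_find sp_empty has_nh.
  have [y tr_y] := not_hof_transformation nhQ.
  have [z zP] := IHm _ (leq_trans (step_potential xQ nhQ tr_y) le_xm).
  by exists z; apply: StepsCons zP; apply: Step.
exists (hof_part x); rewrite hof_partK; first exact: StepsNil.
by move=> P xP; have /hasPn/(_ P xP)/negPn := all_h.
Qed.

End NormalForms.

(** * Invariance of linear extensions under the transformations *)

Section Invariance.
Variable K : fieldType.

Definition sum_respecting n (R : {set 'I_n * 'I_n}) : {malg K[permutation]} :=
  \sum_(s : 'S_n | respects R (fun i => (s^-1)%g i)) << Permutation s >>.

Lemma sum_respectingE n (R : {set 'I_n * 'I_n}) : sum_respecting R =
  \sum_(s : 'S_n)
    if respects R (fun i => (s^-1)%g i) then << Permutation s >> else 0.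
Proof. exact: big_mkcond. Qed.

Lemma Theta_basis (P : special_poset) :
  Theta K << P >> =
    \sum_(s | is_linear_extension P s) << Permutation s >>.
Proof. exact: linextU. Qed.

Lemma Theta_hasse n (P : partial_order n) :
  Theta K << SPoset P >> = sum_respecting (hasse P).
Proof.
by rewrite Theta_basis; apply: eq_bigl => s; apply: linear_extension_hasse.
Qed.

Lemma Theta_generated n (R : {set 'I_n * 'I_n}) : acyclic R ->
  Theta K << SPoset (generated R) >> = sum_respecting R.
Proof.
move=> acR; rewrite Theta_basis; apply: eq_bigl => s.
exact: linear_extension_generated.
Qed.

(** For each total order separately, the signed count of the terms that it extends
    is the same on both sides. *)
Lemma Theta_transformation (Q : special_poset) (y : hspace (HSP K)) :
  transformation Q y -> Theta K y = Theta K << Q >>.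
Proof.
case=> [n P i j Hij|n P i j k Hijk].
- have [/andP[lt_ij Rji] /andP[ac1 ac2]] := (Hij, T1_acyclic Hij).
  transitivity (sum_respecting (T1_rel1 P i j) - sum_respecting (T1_rel2 P i j)).
    by rewrite linearB /=; congr (_ - _); apply: Theta_generated.
  rewrite Theta_hasse -(setD1K Rji).
  rewrite !sum_respectingE -sumrB /=; apply: eq_bigr => s _.
  have /negPf neq_s : (s^-1)%g i != (s^-1)%g j :> nat.
    by rewrite (inj_eq (@inv_perm_inj _ s)) neq_ltn lt_ij.
  rewrite /T1_rel2 !respectsU !respects1 /T1_rel1; case: respects => /=; last first.
    by rewrite !andbF subr0.
  by rewrite !andbT; case: ltngtP neq_s => // _ _; rewrite ?subr0 ?subrr.
- have [/and4P[lt_ij lt_jk Rik Rjk] /and3P[ac1 ac2 ac3]] := (Hijk, T2_acyclic Hijk).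
  transitivity (sum_respecting (T2_rel1 P i j k) - sum_respecting (T2_rel2 P i j k)
                + sum_respecting (T2_rel3 P i j k)).
    rewrite linearD linearB -(Theta_generated ac3) -(Theta_generated ac2).
    by rewrite -(Theta_generated ac1).
  rewrite Theta_hasse.
  pose H := hasse P :\: [set (j, k); (i, k)].
  have E1 : T2_rel1 P i j k = (i, k) |: H.
    apply/setP => e; rewrite in_setD1 in_setU1 in_setD in_set2.
    have [->|_] := eqVneq e (i, k); last by rewrite orbF.
    by rewrite Rik andbT /=; apply/eqP => -[eq_ij]; rewrite eq_ij ltnn in lt_ij.
  rewrite -(setD1K Rjk) /T2_rel2 /T2_rel3 -/(T2_rel1 P i j k) -/H E1.
  rewrite !sum_respectingE -sumrB -big_split /=; apply: eq_bigr => s _.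
  rewrite !respectsU !respects1; case: respects => /=; last first.
    by rewrite !andbF subr0 addr0.
  (* The order of i and k is forced in the first and last cases and cancels in the others. *)
  rewrite !andbT; case: (ltnP ((s^-1)%g i) ((s^-1)%g j)) => lt_s1;
    case: (ltnP ((s^-1)%g j) ((s^-1)%g k)) => lt_s2 /=.
  + by rewrite (ltn_trans lt_s1 lt_s2) subrr add0r.
  + by rewrite subrr addr0.
  + by rewrite subr0 addr0.
  + by rewrite ltnNge (leq_trans lt_s2 lt_s1) subr0 addr0.
Qed.

Lemma linear_replace (V W : lmodType K) (f : {linear V -> W}) x q y c :
  f y = f q -> f (x - c *: q + c *: y) = f x.
Proof. by move=> fyq; rewrite linearD linearB !linearZ /= fyq scalerN subrK. Qed.

Lemma Theta_steps (x y : hspace (HSP K)) : steps x y -> Theta K y = Theta K x.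
Proof.
elim=> // {}x _ z [{}x y' Q _ /Theta_transformation tr] _ ->.
exact: linear_replace.
Qed.

End Invariance.

Section Chains.

Lemma card_ord_lt n m : (m <= n)%N -> #|[set k : 'I_n | (k < m)%N]| = m.
Proof.
move=> le_mn; rewrite -sum1_card (eq_bigl (fun k : 'I_n => (k < m)%N)) => [|k].
  by rewrite (big_ord_narrow le_mn) sum1_card card_ord.
by rewrite inE.
Qed.

Lemma card_perm_lt n (s : 'S_n) m : (m <= n)%N ->
  #|[set j | (s j < m)%N]| = m.
Proof.
move=> le_mn; rewrite -[RHS](card_ord_lt le_mn) -[RHS](card_preimset _ (@perm_inj _ s)).
by apply: eq_card => j; rewrite !inE.
Qed.

(** The value of a permutation at [i] is the number of arguments with a smaller
    value, which depends only on the order of the values. *)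
Lemma perm_eq_order n (s t : 'S_n) :
  (forall i j, (s i < s j)%N -> (t i < t j)%N) -> s = t.
Proof.
move=> st; apply/permP => i; apply/val_inj => /=.
rewrite -[LHS](@card_perm_lt _ s) 1?ltnW // -[RHS](@card_perm_lt _ t) 1?ltnW //.
apply: eq_card => j; rewrite !inE; apply/idP/idP => [/st//|].
apply: contraTT; rewrite -!leqNgt leq_eqVlt.
by case/orP=> [/eqP/val_inj/perm_inj->//|/st/ltnW].
Qed.

Lemma chain_is_order n (s : 'S_n) :
  is_order [set p | ((s^-1)%g p.1 <= (s^-1)%g p.2)%N].
Proof.
apply/is_orderP; split=> [x|x y|y x z]; rewrite !inE //=.
  by move=> xy yx; apply/(@perm_inj _ s^-1)/val_inj/anti_leq; rewrite xy.
exact: leq_trans.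
Qed.

(** The letters of the word of [s], ordered from left to right: the poset whose
    only linear extension is [s]. *)
Definition chain n (s : 'S_n) : special_poset :=
  SPoset (PartialOrder (chain_is_order s)).

Lemma linear_extension_chain n (s t : 'S_n) :
  is_linear_extension (chain s) t = (s == t).
Proof.
apply/forallP/eqP => [H|<- i].
  apply/invg_inj/perm_eq_order => i j lt_ij; have /forallP/(_ j)/implyP := H i; apply.
  rewrite /le1 /ole /= inE /= (ltnW lt_ij) andbT.
  by apply: contraTneq lt_ij => ->; rewrite ltnn.
apply/forallP => j; apply/implyP; rewrite /le1 /ole /= inE /= => /andP[neq_ij].
rewrite leq_eqVlt => /orP[/eqP/val_inj/perm_inj eq_ij|//].
by rewrite eq_ij eqxx in neq_ij.
Qed.

Lemma Theta_chain (K : fieldType) (s : permutation) :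
  Theta K << chain (tagged s) >> = << s >>.
Proof.
rewrite Theta_basis (big_pred1 (tagged s)) => [|t]; first by case: s.
by rewrite /= linear_extension_chain eq_sym.
Qed.

End Chains.

(** * Locating parents by moving one label *)

Section Placement.
Variables (K : fieldType) (T : Type) (r : seq T) (c : T -> K).
Variables (p : T -> nat -> option nat) (n : nat).
Hypothesis p_lt : forall x a b, p x b = Some a -> (a < b)%N.

(** An element of [T] stands for a heap-ordered forest on the labels below [n],
    of which only the parents [p] matter; an injective [pos] stands for a total
    order of the labels. *)
Definition below_parent (q : option nat) (b : nat) (pos : nat -> nat) : bool :=
  if q is Some a then (pos a < pos b)%N else true.

Definition fits (m : nat) (pos : nat -> nat) (x : T) : bool :=
  all (fun b => below_parent (p x b) b pos) (iota 0 m).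

Definition agrees (m : nat) (q : nat -> option nat) (x : T) : bool :=
  all (fun b => p x b == q b) (iota m (n - m)).

Lemma fitsS m pos x :
  fits m.+1 pos x = fits m pos x && below_parent (p x m) m pos.
Proof. by rewrite /fits -addn1 iotaD all_cat /= andbT. Qed.

Lemma agreesS m q x : (m < n)%N ->
  agrees m q x = (p x m == q m) && agrees m.+1 q x.
Proof. by move=> lt_mn; rewrite /agrees -subnSK. Qed.

(** Other labels are moved to odd positions, so that label [m] can be put between
    any two of them: before all those of old position at least [v] and after the
    others. *)
Definition insert_at (m v : nat) (pos : nat -> nat) (i : nat) : nat :=
  if i == m then v.*2 else (pos i).*2.+1.

Lemma insert_at_inj m v pos : injective pos -> injective (insert_at m v pos).
Proof.
move=> inj_pos i j; rewrite /insert_at.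
have odd_even a b : a.*2.+1 <> b.*2 by move/(congr1 odd); rewrite /= !odd_double.
case: eqP => [->|_]; case: eqP => [->|_] //.
- by move/esym/odd_even.
- by move/odd_even.
- by case=> /double_inj/inj_pos.
Qed.

Lemma fits_insert_at m v pos x :
  fits m.+1 (insert_at m v pos) x =
    fits m pos x && (if p x m is Some d then pos d < v else true)%N.
Proof.
rewrite fitsS; congr (_ && _); last first.
  case E: (p x m) => [d|] //=; rewrite /insert_at eqxx.
  by rewrite ltn_eqF ?(p_lt E) // ltn_Sdouble.
apply: eq_in_all => b; rewrite mem_iota add0n => /= lt_bm.
case E: (p x b) => [d|] //=; rewrite /insert_at !ltn_eqF //.
  by rewrite ltnS ltn_double.
exact: ltn_trans (p_lt E) lt_bm.
Qed.

Hypothesis no_fit : forall pos, injective pos ->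
  \sum_(x <- r) c x * (fits n pos x)%:R = 0.

(** Going from [m.+1] to [m] prescribes the parent of label [m].  If it is to be
    [a], subtract the induction hypothesis for [m] placed just before [a] from the one
    for [m] placed just after: the terms that differ are those where [m] has parent [a].  If
    [m] is to be a root, put it first. *)
Lemma sum_agrees_fits m q pos : (m <= n)%N -> injective pos ->
  \sum_(x <- r | agrees m q x) c x * (fits m pos x)%:R = 0.
Proof.
move=> le_mn; rewrite -(subKn le_mn).
(* The induction goes downwards in m, that is, upwards in k = n - m. *)
move: (n - m)%N (leq_subr m n) => {m le_mn} k.
elim: k pos => [|k IHk] pos le_kn inj_pos.
  by rewrite subn0 -[RHS](no_fit inj_pos); apply: eq_bigl => x; rewrite /agrees subnn.
have lt_kn : (n - k.+1 < n)%N by rewrite ltn_subrL (leq_trans _ le_kn).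
have IH v := IHk _ (ltnW le_kn) (@insert_at_inj (n - k.+1)%N v _ inj_pos).
have E : (n - k = (n - k.+1).+1)%N by rewrite subnSK.
move: (n - k.+1)%N lt_kn IH E => l lt_ln IH E; rewrite {}E in IH.
case Eq: (q l) => [a|]; last first.
  rewrite -[RHS](IH 0%N) (eq_bigl (fun x => agrees l.+1 q x && (p x l == None))).
    rewrite big_mkcondr; apply: eq_bigr => x _; rewrite fits_insert_at.
    by case: (p x l) => [d|] /=; rewrite ?andbT // ltn0 andbF mulr0.
  by move=> x; rewrite agreesS // Eq andbC.
have := congr2 (fun u v => u - v) (IH (pos a).+1) (IH (pos a)).
rewrite /= subr0 -sumrB => E0; rewrite -[RHS]E0 {E0}.
rewrite (eq_bigl (fun x => agrees l.+1 q x && (p x l == Some a))); last first.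
  by move=> x; rewrite agreesS // Eq andbC.
rewrite big_mkcondr; apply: eq_bigr => x _; rewrite !fits_insert_at -mulrBr.
case: (p x l) => [d|] /=; last by rewrite subrr mulr0.
rewrite ltnS leq_eqVlt (inj_eq inj_pos) (_ : (Some d == Some a) = (d == a)) //.
have [->|_] := eqVneq d a; first by rewrite ltnn andbT andbF subr0.
by rewrite subrr mulr0.
Qed.

Lemma sum_same_parents q : \sum_(x <- r | agrees 0 q x) c x = 0.
Proof.
rewrite -[RHS](@sum_agrees_fits 0 q id) //.
by apply: eq_bigr => x _; rewrite mulr1.
Qed.

End Placement.

(** * Injectivity of Theta on heap-ordered forests *)

Section RankPermutations.
Variables (n : nat) (f : 'I_n -> nat).
Hypothesis inj_f : injective f.

Fact rank_lt i : (#|[set j | (f j < f i)%N]| < n)%N.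
Proof.
rewrite -[X in (_ < X)%N]card_ord; apply/proper_card/properP; split.
  exact/subsetP.
by exists i; rewrite // inE ltnn.
Qed.

Definition rank i : 'I_n := Ordinal (rank_lt i).

Lemma rank_mono i j : (rank i < rank j)%N = (f i < f j)%N.
Proof.
apply/idP/idP => [|lt_ij].
  apply: contraTT; rewrite -!leqNgt => le_ji; apply/subset_leq_card/subsetP => k.
  by rewrite !inE => /leq_trans->.
apply/proper_card/properP; split.
  by apply/subsetP => k; rewrite !inE => /ltn_trans->.
by exists i; rewrite !inE ?ltnn.
Qed.

Lemma rank_inj : injective rank.
Proof.
move=> i j eq_ij; apply: inj_f.
by case: (ltngtP (f i) (f j)) => //; rewrite -rank_mono eq_ij ltnn.
Qed.

Definition rank_perm : 'S_n := perm rank_inj.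

Lemma rank_permE i j : (rank_perm i < rank_perm j)%N = (f i < f j)%N.
Proof. by rewrite !permE rank_mono. Qed.

End RankPermutations.

Section Parents.

(** Labels are taken in [nat] and not in the vertices of [P], so that the parents
    of all forests are functions of a single type. *)
Definition parent (P : special_poset) (b : nat) : option nat :=
  if insub b is Some j then
    omap val [pick i | (i, j) \in hasse (tagged P)]
  else None.

Section HofParents.
Variables (n : nat) (P : partial_order n).
Hypothesis hofP : is_hof (SPoset P).

Lemma hof_hasse_lt i j : (i, j) \in hasse P -> (i < j)%N.
Proof.
case/hasseP=> ij neq_ij _; have /andP[_ /forallP/(_ i)/forallP/(_ j)/implyP] := hofP.
move=> /(_ ij); rewrite leq_eqVlt => /orP[/eqP/val_inj/eqP|//].
by rewrite (negPf neq_ij).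
Qed.

Lemma hof_hasse_inj i j k : (i, k) \in hasse P -> (j, k) \in hasse P -> i = j.
Proof.
case/hasseP=> ik /eqP neq_ik no_ik /hasseP[jk /eqP neq_jk no_jk].
have /andP[/forallP/(_ k)/forallP/(_ i)/forallP/(_ j)/implyP] := hofP.
rewrite /le1 /= ik jk => /(_ isT)/orP[ij|ji] _.
  by case: (no_ik _ ij jk).
by case: (no_jk _ ji ik).
Qed.

Lemma parentP j a :
  reflect (exists2 i : 'I_n, val i = a & (i, j) \in hasse P)
          (parent (SPoset P) (val j) == Some a).
Proof.
rewrite /parent valK /=; case: pickP => [i Rij|no_i] /=.
  apply: (iffP eqP) => [[<-]|[i' <- /(hof_hasse_inj Rij)->]//]; by exists i.
by apply: (iffP eqP) => // -[i _]; rewrite no_i.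
Qed.

Lemma parent_lt a b : parent (SPoset P) b = Some a -> (a < b)%N.
Proof.
rewrite {1}/parent; case: insubP => // j _ <- /=; case: pickP => //= i Rij [<-].
exact: hof_hasse_lt Rij.
Qed.

Lemma respects_parent pos :
  respects (hasse P) (fun i => pos (val i)) =
  all (fun b => below_parent (parent (SPoset P) b) b pos) (iota 0 n).
Proof.
apply/respectsP/allP => [H b|H i j Rij].
  rewrite mem_iota /= add0n => lt_b; rewrite -[b]/(val (Ordinal lt_b)).
  case E: (parent _ _) => [a|] //=.
  by have /eqP/parentP[i <- Rij] := E; apply: (H _ _ Rij).
have := H j; rewrite mem_iota /= add0n ltn_ord => /(_ isT).
have /parentP/eqP : exists2 i', val i' = val i & (i', j) \in hasse P by exists i.
by move=> ->.
Qed.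

End HofParents.

Lemma hof_eq_parent n (P Q : partial_order n) :
    is_hof (SPoset P) -> is_hof (SPoset Q) ->
    (forall b, (b < n)%N -> parent (SPoset P) b = parent (SPoset Q) b) ->
  P = Q.
Proof.
move=> hP hQ eq_par; have eq_hasse : hasse P = hasse Q.
  apply/setP => -[i j]; have E := eq_par j (ltn_ord j).
  apply/idP/idP => Rij.
    have /(parentP hP) : exists2 i' : 'I_n, val i' = val i & (i', j) \in hasse P.
      by exists i.
    by rewrite E => /(parentP hQ)[i' /val_inj->].
  have /(parentP hQ) : exists2 i' : 'I_n, val i' = val i & (i', j) \in hasse Q.
    by exists i.
  by rewrite -E => /(parentP hP)[i' /val_inj->].
apply/val_inj/setP => -[x y].
have := ole_hasse P x y; rewrite eq_hasse -ole_hasse; exact.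
Qed.

End Parents.

Section ThetaInjective.
Variable K : fieldType.

Lemma mcoeff_Theta n (P : partial_order n) (t : 'S_n) :
  (Theta K << SPoset P >>)@_(Permutation t) =
    (is_linear_extension (SPoset P) t)%:R.
Proof.
rewrite Theta_basis raddf_sum /=.
have E (s : 'S_n) :
    (<< Permutation s >> : {malg K[permutation]})@_(Permutation t) = (s == t)%:R.
  by rewrite mcoeffU; congr (_ %:R); rewrite eq_Tagged.
under eq_bigr do rewrite E.
have [tP|ntP] := boolP (is_linear_extension (SPoset P) t).
  by rewrite (bigD1 t) //= eqxx big1 ?addr0 // => s /andP[_ /negPf->].
by rewrite big1 // => s sP; case: eqP => // eq_st; rewrite -eq_st sP in ntP.
Qed.

Lemma mcoeff_Theta_tag n (t : 'S_n) (P : special_poset) :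
  tag P != n -> (Theta K << P >>)@_(Permutation t) = 0.
Proof.
move=> neq_n; rewrite Theta_basis raddf_sum big1 //= => s _.
rewrite mcoeffU; case: eqP => // /(congr1 tag) /= eq_n.
by rewrite eq_n eqxx in neq_n.
Qed.

Lemma Theta_hofE (x : hspace (HHOF K)) :
  Theta_hof K x = \sum_(F <- msupp x) x@_F *: Theta K << hof_val F >>.
Proof.
rewrite {1}(malg_sumZ x) linear_sum; apply: eq_bigr => F _.
by rewrite linearZZ /= linextU.
Qed.

Lemma respects_rank n (R : {set 'I_n * 'I_n}) f (inj_f : injective f) :
  respects R (fun i => rank_perm inj_f i) = respects R f.
Proof.
by apply/respectsP/respectsP => H i j /H; rewrite rank_permE.
Qed.

Lemma mcoeff_Theta_rank n (F : hof) (pos : nat -> nat) (inj_pos : injective pos) :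
  (Theta K << hof_val F >>)@_(Permutation
      (rank_perm (inj_comp inj_pos (@ord_inj n)))^-1)
    = ((tag (hof_val F) == n)
       && fits (fun F => parent (hof_val F)) n pos F)%:R.
Proof.
case: F => [[m P] hP] /=; have [eq_mn|neq_mn] := eqVneq m n; last first.
  by rewrite mcoeff_Theta_tag.
case: _ / eq_mn; rewrite [LHS]mcoeff_Theta linear_extension_hasse.
rewrite /fits -(respects_parent hP).
rewrite -[in RHS](respects_rank _ (inj_comp inj_pos (@ord_inj m))).
by congr ((nat_of_bool _)%:R); apply: eq_respects => i; rewrite invgK.
Qed.

(** Forests with the same number of vertices and the same parents are equal, so
    [sum_same_parents] for the parents in [F0] reads off the coefficient of
    [F0]. *)
Lemma Theta_hof_inj (x : hspace (HHOF K)) : Theta_hof K x = 0 -> x = 0.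
Proof.
move=> Tx0; apply/malgP => F0; rewrite mcoeff0; apply/eqP/negPn/negP => xF0.
pose n := tag (hof_val F0); pose r := [seq F <- msupp x | tag (hof_val F) == n].
have p_lt (F : hof) a b : parent (hof_val F) b = Some a -> (a < b)%N.
  by case: F => [[m P] hP]; apply: parent_lt hP _ _.
have no_fit pos : injective pos ->
    \sum_(F <- r) x@_F * (fits (fun F => parent (hof_val F)) n pos F)%:R = 0.
  move=> inj_pos; have := congr1 (mcoeff (Permutation
    (rank_perm (inj_comp inj_pos (@ord_inj n)))^-1)) Tx0.
  rewrite mcoeff0 Theta_hofE raddf_sum /= => E0; rewrite -[RHS]E0 big_filter big_mkcond.
  apply: eq_bigr => F _; rewrite mcoeffZ mcoeff_Theta_rank.
  by case: (_ == n); rewrite ?mulr0.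
have := sum_same_parents p_lt no_fit (parent (hof_val F0)).
rewrite /r big_filter_cond big_mkcond (bigD1_seq F0) ?fset_uniq -?mcoeff_neq0 //=.
have agrees0 (F : hof) :
    agrees (fun F => parent (hof_val F)) n 0 (parent (hof_val F0)) F
    = all (fun b => parent (hof_val F) b == parent (hof_val F0) b) (iota 0 n).
  by rewrite /agrees subn0.
rewrite big1 => [|F neq_F]; last first.
  case: ifP => // /andP[/eqP eq_n]; rewrite agrees0 => /allP eq_par.
  case/eqP: neq_F; apply/val_inj => /=; move: eq_par; rewrite /n in eq_n *.
  case: F F0 eq_n {x Tx0 xF0 n r p_lt no_fit agrees0}
    => [[m P] hP] [[m' P'] hP'] /= eq_m.
  case: _ / eq_m P' hP' => P' hP' eq_par; congr existT.
  apply: (hof_eq_parent hP hP') => b lt_b.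
  by apply/eqP/eq_par; rewrite mem_iota add0n.
rewrite eqxx agrees0 addr0 (introT allP) => [|b _]; last exact: eqxx.
by move/eqP; apply/negP.
Qed.

End ThetaInjective.

(** * Words and shuffles *)

Section Words.

Lemma size_word n (s : 'S_n) : size (word s) = n.
Proof. by rewrite size_map size_enum_ord. Qed.

Lemma nth_word n (s : 'S_n) (p : 'I_n) : nth 0%N (word s) p = s p.
Proof. by rewrite (nth_map p) ?size_enum_ord // nth_ord_enum. Qed.

Lemma word_inj n : injective (@word n).
Proof.
move=> s t eq_st; apply/permP => p; apply/val_inj.
by rewrite /= -!nth_word eq_st.
Qed.

Lemma word_uniq n (s : 'S_n) : uniq (word s).
Proof. by rewrite map_inj_uniq ?enum_uniq // => i j /val_inj/perm_inj. Qed.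

Lemma mem_word n (s : 'S_n) x : (x \in word s) = (x < n)%N.
Proof.
apply/mapP/idP => [[i _ ->]|lt_xn]; first exact: ltn_ord.
by exists ((s^-1)%g (Ordinal lt_xn)); rewrite ?mem_enum ?permKV.
Qed.

Lemma index_word n (s : 'S_n) (x : 'I_n) : index (val x) (word s) = (s^-1)%g x.
Proof.
rewrite -{1}(permKV s x) (index_map (f := fun i => val (s i))) ?index_enum_ord //.
by move=> i j /val_inj/perm_inj.
Qed.

Lemma enum_ord_sorted n : sorted (fun i j : 'I_n => (i < j)%N) (enum 'I_n).
Proof.
by have := iota_ltn_sorted 0 n; rewrite -val_enum_ord sorted_map.
Qed.

Definition precedes (w : seq nat) : rel nat :=
  fun x y => (index x w < index y w)%N.

Lemma precedes_sorted w : uniq w -> sorted (precedes w) w.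
Proof.
move=> uniq_w; apply/(sortedP 0%N) => i lt_i.
by rewrite /precedes !index_uniq // (ltn_trans (ltnSn i)).
Qed.

(** Two lists with the same letters coincide as soon as both list them in the
    order in which they occur in [w], as the subwords of [w] do. *)
Lemma precedes_sorted_eq w w1 w2 :
  sorted (precedes w) w1 -> sorted (precedes w) w2 -> w1 =i w2 -> w1 = w2.
Proof.
apply: irr_sorted_eq => [x y z|x]; last exact: ltnn.
exact: ltn_trans.
Qed.

Lemma nil_shuffle u v : ([::] \in shuffle u v) = nilp u && nilp v.
Proof.
case: u v => [|a u] [|b v] //=; rewrite mem_cat.
by apply/norP; split; apply/mapP => -[].
Qed.

Lemma mem_map_cons (a x : nat) w (L : seq (seq nat)) :
  (x :: w \in [seq a :: z | z <- L]) = (x == a) && (w \in L).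
Proof.
apply/mapP/andP => [[z Lz [-> ->]]|[/eqP-> Lw]]; last by exists w.
by rewrite eqxx.
Qed.

(** When the letters of [u] and [v] are told apart by [a], a shuffle is recognized
    by extracting its two parts. *)
Lemma mem_shuffle (a : pred nat) u v w : all a u -> all (predC a) v ->
  (w \in shuffle u v) = (filter a w == u) && (filter (predC a) w == v).
Proof.
have one_sided (b : pred nat) z y : all b z ->
    (y == z) = (filter (predC b) y == [::]) && (filter b y == z).
  move=> bz; apply/eqP/andP => [->|[]].
    split; last exact/eqP/all_filterP.
    rewrite -(negbK (_ == _)) -has_filter has_predC negbK.
    by apply: sub_all bz => i /= ->.
  rewrite -(negbK (_ == [::])) -has_filter has_predC /= => /negPn by_ /eqP <-.
  by symmetry; apply/all_filterP.
have filterCC z : filter (predC (predC a)) z = filter a z.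
  by apply: eq_filter => i /=; rewrite negbK.
elim: w u v => [|x w IHw] u v; first by rewrite nil_shuffle; case: u v => [|? ?] [|? ?].
case: u v => [|c u] [|d v] au av.
- by rewrite mem_seq1 (one_sided a) // andbC.
- by rewrite mem_seq1 (one_sided (predC a)) // filterCC.
- by rewrite mem_seq1 (one_sided a) // andbC.
have [/= /andP[ac au'] /andP[ad av']] := (au, av).
rewrite mem_cat !mem_map_cons (IHw u (d :: v)) // (IHw (c :: u) v) //.
case: ifP => ax /=; rewrite ?eqseq_cons; last first.
  have -> : (x == c) = false by apply: contraFF ax => /eqP->.
  by case: (x == d); rewrite ?andbF ?andbT.
have -> : (x == d) = false by apply: contraNF ad => /eqP<-.
by rewrite orbF andbA.
Qed.

End Words.

(** * Linear extensions of a product *)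

Lemma linear_extensionP n (P : partial_order n) (s : 'S_n) :
  reflect (forall i j, i != j -> ole P i j -> ((s^-1)%g i < (s^-1)%g j)%N)
          (is_linear_extension (SPoset P) s).
Proof.
apply: (iffP forallP) => [H i j neq_ij ij|H i].
  by have /forallP/(_ j)/implyP := H i; apply; rewrite neq_ij.
by apply/forallP => j; apply/implyP => /andP[]; apply: H.
Qed.

Section ProductExtensions.
Variables (m n : nat) (r : 'S_(m + n)).

Definition left_pos (i : 'I_m) : nat := (r^-1)%g (lshift n i).
Definition right_pos (j : 'I_n) : nat := (r^-1)%g (rshift m j).

Lemma left_pos_inj : injective left_pos.
Proof. by move=> i j /val_inj/perm_inj/lshift_inj. Qed.

Lemma right_pos_inj : injective right_pos.
Proof. by move=> i j /val_inj/perm_inj/rshift_inj. Qed.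

Definition left_perm : 'S_m := ((rank_perm left_pos_inj)^-1)%g.
Definition right_perm : 'S_n := ((rank_perm right_pos_inj)^-1)%g.

Lemma word_left_perm : word left_perm = [seq x <- word r | (x < m)%N].
Proof.
apply: (@precedes_sorted_eq (word r)) => [||x].
- rewrite /word; apply: (homo_sorted (e := fun i j : 'I_m => (i < j)%N)); last first.
    exact: enum_ord_sorted.
  move=> p q lt_pq; rewrite /precedes (index_word r (lshift n (left_perm p))).
  rewrite (index_word r (lshift n (left_perm q))).
  by rewrite -!/(left_pos _) -(rank_permE left_pos_inj) !permKV.
- apply: sorted_filter (precedes_sorted (word_uniq _)) => x y z; exact: ltn_trans.
rewrite mem_filter !mem_word; case: ltnP => //= lt_xm.
by rewrite (leq_trans lt_xm) ?leq_addr.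
Qed.

Lemma word_right_perm :
  [seq (m + a)%N | a <- word right_perm] =
    [seq x <- word r | predC (fun x => x < m)%N x].
Proof.
apply: (@precedes_sorted_eq (word r)) => [||x].
- rewrite /word -map_comp.
  apply: (homo_sorted (e := fun i j : 'I_n => (i < j)%N)); last first.
    exact: enum_ord_sorted.
  move=> p q lt_pq; rewrite /precedes /= (index_word r (rshift m (right_perm p))).
  rewrite (index_word r (rshift m (right_perm q))).
  by rewrite -!/(right_pos _) -(rank_permE right_pos_inj) !permKV.
- apply: sorted_filter (precedes_sorted (word_uniq _)) => x y z; exact: ltn_trans.
rewrite mem_filter mem_word /= -leqNgt; apply/mapP/andP => [[a]|[le_mx lt_x]].
  by rewrite mem_word => lt_an ->; rewrite leq_addr ltn_add2l.
by exists (x - m)%N; rewrite ?mem_word ?subnKC // ltn_subLR.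
Qed.

(** Every permutation occurs in exactly one product of two basis elements of sizes
    [m] and [n]. *)
Lemma shuffle_word (s : 'S_m) (t : 'S_n) :
  (word r \in shuffle (word s) [seq (m + a)%N | a <- word t]) =
    (s == left_perm) && (t == right_perm).
Proof.
rewrite (mem_shuffle (a := fun x => x < m)%N); last 2 first.
- by apply/allP => x; rewrite mem_word.
- by apply/allP => x /mapP[a _ ->] /=; rewrite -leqNgt leq_addr.
rewrite -word_left_perm -word_right_perm (inj_eq (@word_inj m)) eq_sym.
by rewrite (inj_eq (inj_map (@addnI m))) (inj_eq (@word_inj n)) [right_perm == t]eq_sym.
Qed.

Lemma linear_extension_prod (P : partial_order m) (Q : partial_order n) :
  is_linear_extension (sp_mul (SPoset P) (SPoset Q)) r =
    is_linear_extension (SPoset P) left_perm &&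
    is_linear_extension (SPoset Q) right_perm.
Proof.
apply/linear_extensionP/andP => [H|[/linear_extensionP HP /linear_extensionP HQ] i j].
  split; apply/linear_extensionP => i j neq_ij ij; rewrite invgK rank_permE; apply: H.
  - by rewrite (inj_eq (@lshift_inj _ _)).
  - by rewrite /ole inE /= !(unsplitK (inl _)).
  - by rewrite (inj_eq (@rshift_inj _ _)).
  - by rewrite /ole inE /= !(unsplitK (inr _)).
rewrite -(splitK i) -(splitK j) /ole inE /= !unsplitK.
case: (split i) (split j) => a [] b //=.
- rewrite (inj_eq (@lshift_inj _ _)) => neq_ab /(HP _ _ neq_ab).
  by rewrite invgK rank_permE.
- rewrite (inj_eq (@rshift_inj _ _)) => neq_ab /(HQ _ _ neq_ab).
  by rewrite invgK rank_permE.
Qed.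

End ProductExtensions.

Lemma Theta_mul (K : fieldType) (P Q : special_poset) :
  Theta K << sp_mul P Q >> = hmul (Theta K << P >>) (Theta K << Q >>).
Proof.
apply: etrans (Theta_basis _ _) _.
apply: etrans (esym (congr2 (@hmul K (FQSym K)) (Theta_basis K P) (Theta_basis K Q))).
case: P Q => m P [n Q].
rewrite [RHS]bilext_suml; under [RHS]eq_bigr => s _ do rewrite bilext_sumr.
under [RHS]eq_bigr => s _ do under eq_bigr => t _ do rewrite bilextUU.
rewrite pair_big /= (exchange_big_dep xpredT) //= big_mkcond /=; apply: eq_bigr => r _.
set z := << _ >>; rewrite [X in if X then _ else _]linear_extension_prod.
rewrite (eq_bigl (fun p => (is_linear_extension (SPoset P) p.1 &&
    is_linear_extension (SPoset Q) p.2) && (p == (left_perm r, right_perm r)))).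
  by rewrite big_mkcondl /= big_pred1_eq.
by move=> [s t]; rewrite /= shuffle_word.
Qed.

(** * Linear extensions and ideals *)

Section Standardizations.

Lemma permutation_word_inj (s t : permutation) :
  word (tagged s) = word (tagged t) -> s = t.
Proof.
case: s t => [m s] [n t] /= eq_w; have eq_mn := congr1 size eq_w.
rewrite !size_word in eq_mn; case: _ / eq_mn t eq_w => t /word_inj-> //.
Qed.

Lemma card_count n (a : pred 'I_n) : #|[set j | a j]| = count a (enum 'I_n).
Proof.
rewrite cardE {1}/enum_mem -enumT size_filter; apply: eq_count => j.
by rewrite /= inE.
Qed.

Lemma word_standardization w : uniq w ->
  word (standardization w) = [seq count (fun y => y < x)%N w | x <- w].
Proof.
move=> uniq_w; apply: (@eq_from_nth _ 0%N); rewrite size_word ?size_map // => i lt_i.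
rewrite (nth_word _ (Ordinal lt_i)) permE /= (nth_map 0%N) // card_count.
rewrite -[X in _ = count _ X](mkseq_nth 0%N w) /mkseq -val_enum_ord -map_comp count_map.
apply: eq_count => j; rewrite /= /std_lt /= nth_uniq //.
by rewrite [(_ == i) && _](_ : _ = false) ?orbF //; case: eqVneq => // ->; rewrite ltnn.
Qed.

(** Standardization undoes any increasing relabelling of the letters. *)
Lemma standardization_mono m (u : 'S_m) (e : 'I_m -> nat) :
    {mono e : i j / (i < j)%N} ->
  Permutation (standardization [seq e (u p) | p <- enum 'I_m]) = Permutation u.
Proof.
move=> mono_e; have inj_e : injective e.
  by move=> i j eq_ij; apply/val_inj; case: (ltngtP i j) => //;
    rewrite -mono_e eq_ij ltnn.
apply: permutation_word_inj => /=; rewrite word_standardization; last first.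
  by rewrite map_inj_uniq ?enum_uniq // => p q /inj_e/perm_inj.
rewrite /word -map_comp; apply: eq_map => p /=.
rewrite count_map -[RHS](@card_perm_lt _ u (u p)) 1?ltnW // card_count.
by apply: eq_count => q /=; rewrite mono_e.
Qed.

End Standardizations.

Section CoproductExtensions.
Variables (n : nat) (P : partial_order n).
Implicit Types (s : 'S_n) (A I : {set 'I_n}).

Definition sub_pos A s (i : 'I_#|A|) : nat := (s^-1)%g (enum_val i).

Lemma sub_pos_inj A s : injective (sub_pos (A := A) s).
Proof. by move=> i j /val_inj/perm_inj/enum_val_inj. Qed.

(** The permutation of [A] induced by [s], with the elements of [A] renumbered
    increasingly: the standardization of the subword of [s] with letters in [A]. *)
Definition sub_perm A s : 'S_#|A| := ((rank_perm (@sub_pos_inj A s))^-1)%g.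

Lemma sub_permV A s i j :
  (((sub_perm A s)^-1)%g i < ((sub_perm A s)^-1)%g j)%N =
    ((s^-1)%g (enum_val i) < (s^-1)%g (enum_val j))%N.
Proof. by rewrite invgK rank_permE. Qed.

Definition suffix s (k : nat) : {set 'I_n} := [set x | k <= (s^-1)%g x]%N.

(** The letters of [I] form the end of the word of [s]; the cut is then at
    position [#|~: I|]. *)
Definition splits I s : bool := suffix s #|~: I| == I.

Lemma card_suffixC s k : (k <= n)%N -> #|~: suffix s k| = k.
Proof.
move=> le_kn; rewrite -[RHS](@card_perm_lt _ (s^-1)%g k) //.
by apply: eq_card => x; rewrite !inE -ltnNge.
Qed.

Lemma splitsP I s : splits I s ->
  forall x, (x \in I) = (#|~: I| <= (s^-1)%g x)%N.
Proof. by move/eqP=> defI x; rewrite -{1}defI inE. Qed.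

Lemma enum_val_cases I x :
  (exists i, x = enum_val (A := mem (~: I)) i) \/
  (exists i, x = enum_val (A := mem I) i).
Proof.
have [xI|xI] := boolP (x \in I).
  by right; exists (enum_rank_in xI x); rewrite enum_rankK_in.
rewrite -in_setC in xI.
by left; exists (enum_rank_in xI x); rewrite enum_rankK_in.
Qed.

(** The letters outside [I] fill the first positions, so the rank of a position
    among theirs is the position itself. *)
Lemma sub_permC_val I s i : splits I s ->
  ((sub_perm (~: I) s)^-1)%g i = (s^-1)%g (enum_val i) :> nat.
Proof.
move=> /splitsP defI; rewrite invgK permE /= -[RHS](@card_perm_lt _ (s^-1)%g) 1?ltnW //.
rewrite -(card_imset _ enum_val_inj); apply: eq_card => x; rewrite !inE.
apply/imsetP/idP => [[j]|lt_x]; first by rewrite inE => lt_ji ->.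
case: (enum_val_cases I x) => -[j def_x].
  by exists j; rewrite // inE /sub_pos -def_x.
have := enum_valP i; have := enum_valP j; rewrite -def_x inE !defI -ltnNge.
by move=> le_kx lt_ik; have := leq_trans (ltn_trans lt_x lt_ik) le_kx; rewrite ltnn.
Qed.

Lemma sub_perm_val I s i : splits I s ->
  (#|~: I| + ((sub_perm I s)^-1)%g i)%N = (s^-1)%g (enum_val i) :> nat.
Proof.
move=> /splitsP defI; rewrite invgK permE /= -[RHS](@card_perm_lt _ (s^-1)%g) 1?ltnW //.
rewrite -(cardsID I) addnC; congr (_ + _)%N.
  rewrite -(card_imset _ enum_val_inj); apply: eq_card => x; rewrite !inE.
  apply/imsetP/andP => [[j]|[lt_x xI]].
    by rewrite inE => lt_ji ->; rewrite enum_valP.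
  exists (enum_rank_in xI x); last by rewrite enum_rankK_in.
  by rewrite inE /sub_pos enum_rankK_in.
apply: eq_card => x; rewrite !inE; case xI: (x \in I) => //=.
have := enum_valP i; rewrite defI => /(leq_trans _)->//.
by rewrite ltnNge -defI xI.
Qed.

Lemma take_word I s : splits I s ->
  take #|~: I| (word s) =
    [seq val (enum_val (sub_perm (~: I) s p)) | p <- enum 'I_#|~: I|].
Proof.
move=> split_s; have le_n : (#|~: I| <= n)%N.
  by rewrite -[X in (_ <= X)%N]card_ord max_card.
have sz : size (take #|~: I| (word s)) = #|~: I| by rewrite size_takel ?size_word.
apply: (@eq_from_nth _ 0%N); rewrite sz ?size_map -?enumT ?size_enum_ord // => p lt_p.
rewrite nth_take // (nth_word s (Ordinal (leq_trans lt_p le_n))).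
rewrite (nth_map (Ordinal lt_p)) ?size_enum_ord //.
rewrite -[X in nth _ _ X]/(val (Ordinal lt_p)).
rewrite nth_ord_enum; congr (val _); apply: (canLR (permKV s)); apply/val_inj => /=.
by rewrite -sub_permC_val // permK.
Qed.

Lemma drop_word I s : splits I s ->
  drop #|~: I| (word s) =
    [seq val (enum_val (sub_perm I s p)) | p <- enum 'I_#|I|].
Proof.
move=> split_s; have cI : (#|~: I| + #|I|)%N = n by rewrite addnC cardsC card_ord.
have sz : size (drop #|~: I| (word s)) = #|I|.
  by rewrite size_drop size_word -[X in (X - _)%N]cI addKn.
apply: (@eq_from_nth _ 0%N); rewrite sz ?size_map -?enumT ?size_enum_ord // => p lt_p.
have lt_n : (#|~: I| + p < n)%N by rewrite -[X in (_ < X)%N]cI ltn_add2l.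
rewrite nth_drop (nth_word s (Ordinal lt_n)).
rewrite (nth_map (Ordinal lt_p)) ?size_enum_ord //.
rewrite -[X in nth _ _ X]/(val (Ordinal lt_p)).
rewrite nth_ord_enum; congr (val _); apply: (canLR (permKV s)); apply/val_inj => /=.
by rewrite -sub_perm_val // permK.
Qed.

Lemma enum_val_mono A : {mono (fun i : 'I_#|A| => val (enum_val i)) : i j / (i < j)%N}.
Proof. by move=> i j; rewrite ltnNge enum_val_le -ltnNge. Qed.

(** That [I] is an ideal expresses exactly that no relation goes from a letter of
    the second part back to one of the first. *)
Lemma linear_extension_splits I s : splits I s ->
  is_linear_extension (SPoset P) s =
    [&& is_ideal (SPoset P) I,
        is_linear_extension (sp_restr (SPoset P) (~: I)) (sub_perm (~: I) s) &
        is_linear_extension (sp_restr (SPoset P) I) (sub_perm I s)].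
Proof.
move=> /splitsP defI.
have restrE A i j :
    ole (PartialOrder (restr_is_order P A)) i j = ole P (enum_val i) (enum_val j).
  by rewrite /ole inE.
apply/linear_extensionP/and3P =>
  [H|[/forall_inP idI /linear_extensionP HC /linear_extensionP HI] x y].
  split.
  - apply/forall_inP => x xI; apply/forallP => y; apply/implyP => xy.
    have [<-//|neq_xy] := eqVneq x y; rewrite !defI in xI *.
    exact: leq_trans xI (ltnW (H _ _ neq_xy xy)).
  - apply/linear_extensionP => i j neq_ij; rewrite restrE sub_permV => /H; apply.
    by rewrite (inj_eq enum_val_inj).
  - apply/linear_extensionP => i j neq_ij; rewrite restrE sub_permV => /H; apply.
    by rewrite (inj_eq enum_val_inj).
case: (enum_val_cases I x) => -[i ->]; case: (enum_val_cases I y) => -[j ->].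
- rewrite (inj_eq enum_val_inj) => neq_ij ij; rewrite -sub_permV.
  by apply: HC; rewrite ?restrE.
- move=> _ _; have := enum_valP j; have := enum_valP i; rewrite inE !defI -ltnNge.
  exact: leq_trans.
- move=> _ ij; have := enum_valP j; rewrite inE => /negP[].
  by have /forallP/(_ (enum_val j))/implyP := idI _ (enum_valP i); apply.
- rewrite (inj_eq enum_val_inj) => neq_ij ij; rewrite -sub_permV.
  by apply: HI; rewrite ?restrE.
Qed.

Lemma splits_inj I s t : splits I s -> splits I t ->
  sub_perm (~: I) s = sub_perm (~: I) t -> sub_perm I s = sub_perm I t -> s = t.
Proof.
move=> sI tI eqC eqI; apply/invg_inj/permP => x; apply/val_inj => /=.
case: (enum_val_cases I x) => -[i ->].
  by rewrite -!sub_permC_val // eqC.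
by rewrite -!sub_perm_val // eqI.
Qed.

Section Glue.
Variables (I : {set 'I_n}) (a : 'S_#|~: I|) (b : 'S_#|I|).

(** The position of [x] when the word of [a], renumbered by the elements of the
    complement of [I], is followed by the word of [b], renumbered by those of [I].
    Each [x] is in the range of exactly one of the two numberings, so the last value
    is never taken. *)
Definition glue_pos (x : 'I_n) : nat :=
  if [pick i | enum_val (A := mem (~: I)) i == x] is Some i then (a^-1)%g i
  else if [pick j | enum_val (A := mem I) j == x] is Some j
  then (#|~: I| + (b^-1)%g j)%N else 0%N.

Lemma glue_posC i : glue_pos (enum_val (A := mem (~: I)) i) = (a^-1)%g i.
Proof.
rewrite /glue_pos; case: pickP => [j /eqP/enum_val_inj-> //|/(_ i)].
by rewrite eqxx.
Qed.

Lemma glue_posI j : glue_pos (enum_val (A := mem I) j) = (#|~: I| + (b^-1)%g j)%N.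
Proof.
rewrite /glue_pos; case: pickP => [i /eqP eq_ij|_].
  by have := enum_valP i; rewrite eq_ij inE enum_valP.
case: pickP => [i /eqP/enum_val_inj-> //|/(_ j)].
by rewrite eqxx.
Qed.

Lemma glue_pos_lt x : (glue_pos x < #|~: I|)%N = (x \notin I).
Proof.
case: (enum_val_cases I x) => -[i ->].
  by rewrite glue_posC ltn_ord -in_setC enum_valP.
by rewrite glue_posI enum_valP ltnNge leq_addr.
Qed.

Lemma glue_pos_inj : injective glue_pos.
Proof.
move=> x y eq_xy; have := glue_pos_lt x; rewrite eq_xy glue_pos_lt; move: eq_xy.
case: (enum_val_cases I x) => -[i ->]; case: (enum_val_cases I y) => -[j ->].
- by rewrite !glue_posC => /val_inj/perm_inj->.
- by have := enum_valP i; rewrite inE => -> _; rewrite enum_valP.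
- by have := enum_valP j; rewrite inE => -> _; rewrite enum_valP.
- by rewrite !glue_posI => /addnI/val_inj/perm_inj->.
Qed.

Definition glue : 'S_n := ((rank_perm glue_pos_inj)^-1)%g.

Lemma glueK : (sub_perm (~: I) glue, sub_perm I glue) = (a, b).
Proof.
congr (_, _); apply/invg_inj/perm_eq_order => i j; rewrite sub_permV invgK rank_permE.
  by rewrite !glue_posC.
by rewrite !glue_posI ltn_add2l.
Qed.

Lemma splits_glue : splits I glue.
Proof.
apply/eqP/setP => x; rewrite inE invgK permE /=.
case xI: (x \in I); have := glue_pos_lt x; rewrite xI /=.
  move/negbT; rewrite -leqNgt => le_kx; apply/subset_leq_card/subsetP => y.
  by rewrite !inE -glue_pos_lt => /leq_trans->.
move=> lt_xk; apply/negbTE; rewrite -ltnNge; apply/proper_card/properP; split.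
  by apply/subsetP => y; rewrite !inE -glue_pos_lt => /ltn_trans->.
by exists x; rewrite !inE ?ltnn ?xI.
Qed.

End Glue.

(** Gluing is inverse to restricting, between the pairs of linear extensions and
    the linear extensions in which [I] comes last. *)
Lemma sum_splits (V : nmodType) (F : permutation * permutation -> V) I :
  \sum_(s : 'S_n | is_linear_extension (SPoset P) s && splits I s)
      F (Permutation (sub_perm (~: I) s), Permutation (sub_perm I s)) =
  \sum_(ab : 'S_#|~: I| * 'S_#|I| |
      [&& is_ideal (SPoset P) I,
          is_linear_extension (sp_restr (SPoset P) (~: I)) ab.1 &
          is_linear_extension (sp_restr (SPoset P) I) ab.2])
      F (Permutation ab.1, Permutation ab.2).
Proof.
rewrite [RHS](reindex_onto (fun s => (sub_perm (~: I) s, sub_perm I s))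
                           (fun ab => glue ab.1 ab.2)) => [|[a b] _]; last exact: glueK.
apply: eq_bigl => s; case split_s: (splits I s); last first.
  rewrite andbF; apply/esym/negbTE/negP => /andP[_ /eqP eq_s].
  by rewrite -eq_s splits_glue in split_s.
rewrite andbT (linear_extension_splits split_s) /=.
rewrite (_ : (glue _ _ == s) = true) ?andbT //; apply/eqP.
have [eqC eqI] := glueK (sub_perm (~: I) s) (sub_perm I s).
by apply: splits_inj eqC eqI => //; apply: splits_glue.
Qed.

(** In a given word, the cut position and the set of letters after the
    cut determine each other. *)
Lemma sum_cuts (V : nmodType) (F : permutation * permutation -> V) s :
  \sum_(k < n.+1) F (Permutation (standardization (take k (word s))),
                     Permutation (standardization (drop k (word s)))) =
  \sum_(I | splits I s)
      F (Permutation (sub_perm (~: I) s), Permutation (sub_perm I s)).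
Proof.
rewrite (reindex_onto (fun I => inord #|~: I|)
                      (fun k : 'I_n.+1 => suffix s k)) => [|k _].
  have valI I : (inord #|~: I| : 'I_n.+1) = #|~: I| :> nat.
    by rewrite inordK // ltnS -[X in (_ <= X)%N]card_ord max_card.
  apply: eq_big => I; rewrite /= valI //.
  move=> split_s; rewrite take_word // drop_word //.
  by rewrite !(standardization_mono _ (@enum_val_mono _)).
by rewrite card_suffixC ?inord_val // -ltnS.
Qed.

End CoproductExtensions.

Lemma Theta_comul (K : fieldType) (P : special_poset) :
  hcomul (Theta K << P >>) = tensmap (Theta K) (hcomul1 (P : hbasis (HSP K))).
Proof.
have -> : Theta K << P >> = _ := Theta_basis K P.
rewrite /hcomul /tensmap linear_sum [RHS]linear_sum /=.
have tensE I : tens (Theta K << sp_restr P (~: I) >>) (Theta K << sp_restr P I >>) =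
    \sum_(ab : 'S_#|~: I| * 'S_#|I| |
        is_linear_extension (sp_restr P (~: I)) ab.1 &&
        is_linear_extension (sp_restr P I) ab.2)
      << (Permutation ab.1, Permutation ab.2) >>.
  apply: etrans (congr2 (@tens K _ _) (Theta_basis _ _) (Theta_basis _ _)) _.
  rewrite [LHS]bilext_suml; under [LHS]eq_bigr => s _ do rewrite bilext_sumr.
  under [LHS]eq_bigr => s _ do under eq_bigr => t _ do rewrite bilextUU.
  by rewrite pair_big.
under [RHS]eq_bigr => I _ do rewrite linextU /= tensE.
under [LHS]eq_bigr => s _ do rewrite linextU /=.
case: P {tensE} => n P; rewrite [RHS]big_mkcond /=.
transitivity (\sum_(I : {set 'I_n})
    \sum_(s : 'S_n | is_linear_extension (SPoset P) s && splits I s)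
      << (Permutation (sub_perm (~: I) s), Permutation (sub_perm I s)) >>
    : {malg K[(permutation * permutation)%type]}).
  rewrite -(exchange_big_dep xpredT) //; apply: eq_bigr => s _.
  exact: (sum_cuts (fun p => << p >>)).
apply: eq_bigr => I _; rewrite [LHS](sum_splits P (fun p => << p >>)).
by case: ifP => _ //=; apply: big_pred0.
Qed.

(** * The pairing in terms of linear extensions *)

Section Isometry.
Variable K : fieldType.

Definition inverse_permutation (s : permutation) : permutation :=
  Permutation ((tagged s)^-1)%g.

Definition permutation_form (s t : permutation) : K^o :=
  (s == inverse_permutation t)%:R.

Lemma linear_extension_inv n (P : partial_order n) (t : 'S_n) :
  reflect (forall i j, ole P i j -> (t i <= t j)%N)
          (is_linear_extension (SPoset P) t^-1).
Proof.
apply: (iffP (linear_extensionP _ _)) => H i j; rewrite ?invgK.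
  have [->//|neq_ij ij] := eqVneq i j.
  by have := H _ _ neq_ij ij; rewrite invgK => /ltnW.
move=> neq_ij /H; rewrite leq_eqVlt => /orP[/eqP/val_inj/perm_inj/eqP|//].
by rewrite (negPf neq_ij).
Qed.

(** The two conditions on a bijection [t] are that its inverse is a linear extension
    of [P] and that [t] itself is one of [Q]. *)
Lemma pairing_num_perm n (P Q : partial_order n) :
  pairing_num (SPoset P) (SPoset Q) =
    #|[set t : 'S_n | is_linear_extension (SPoset P) t^-1 &&
                      is_linear_extension (SPoset Q) t]|.
Proof.
have inj_ffun : injective (fun t : 'S_n => [ffun i => t i]).
  by move=> s t /ffunP eq_st; apply/permP => i; have := eq_st i; rewrite !ffunE.
rewrite -(card_imset _ inj_ffun); apply: eq_card => f; rewrite inE.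
apply/and4P/imsetP => [[/injectiveP inj_f _ fP fQ]|[t]].
  exists (perm inj_f); last by apply/ffunP => i; rewrite ffunE permE.
  rewrite inE -{2}[perm inj_f]invgK; apply/andP; split;
    apply/linear_extension_inv => i j ij.
    by rewrite !permE; have /forallP/(_ i)/forallP/(_ j)/implyP := fP; apply.
  have := fQ => /forallP/(_ ((perm inj_f)^-1 i)%g).
  move/forallP/(_ ((perm inj_f)^-1 j)%g)/implyP.
  by apply; rewrite /le1 -!(permE inj_f) !permKV.
rewrite inE -{2}[t]invgK => /andP[/linear_extension_inv tP /linear_extension_inv tQ] ->.
split.
- by apply/injectiveP => i j; rewrite !ffunE => /perm_inj.
- by apply/forallP => y; apply/codomP; exists ((t^-1)%g y); rewrite ffunE permKV.
- by apply/forallP => i; apply/forallP => j; apply/implyP => /tP; rewrite !ffunE.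
- apply/forallP => i; apply/forallP => j; apply/implyP; rewrite !ffunE => /tQ.
  by rewrite !permK.
Qed.

Lemma pairing_num_eq0 (P Q : special_poset) : tag P != tag Q -> pairing_num P Q = 0%N.
Proof.
move=> neq_PQ; apply/eqP; rewrite cards_eq0; apply/eqP/setP => f; rewrite !inE.
apply/negbTE; apply: contra neq_PQ => /and4P[/injectiveP inj_f /forallP onto _ _].
apply/eqP; rewrite -[LHS]card_ord -[RHS]card_ord; apply/eqP; rewrite eqn_leq.
rewrite (leq_card f inj_f) /= -(card_codom inj_f); apply/subset_leq_card/subsetP => y _.
exact: onto.
Qed.

Lemma sum_permutation_form n (P Q : partial_order n) :
  #|[set t : 'S_n | is_linear_extension (SPoset P) t^-1 &&
                    is_linear_extension (SPoset Q) t]|%:R =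
  \sum_(s : 'S_n | is_linear_extension (SPoset P) s)
    \sum_(t : 'S_n | is_linear_extension (SPoset Q) t)
       permutation_form (Permutation s) (Permutation t).
Proof.
rewrite -sum1_card natr_sum exchange_big /= [LHS]big_mkcond [RHS]big_mkcond.
apply: eq_bigr => t _; rewrite inE.
case: (is_linear_extension (SPoset Q) t); rewrite ?andbF ?andbT //.
rewrite (eq_bigr (fun s : 'S_n => (s == t^-1)%g%:R)) => [|s _]; last first.
  by rewrite /permutation_form /inverse_permutation eq_Tagged.
case: ifP => tP.
  by rewrite (bigD1 (t^-1)%g) //= eqxx big1 ?addr0 // => s /andP[_ /negPf->].
by rewrite big1 // => s sP; case: eqP => // eq_s; rewrite -eq_s sP in tP.
Qed.

Lemma pairing_num_Theta (P Q : special_poset) :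
  (pairing_num P Q)%:R = bilext permutation_form (Theta K << P >>) (Theta K << Q >>).
Proof.
apply: etrans (esym (congr2 (bilext permutation_form)
  (Theta_basis K P) (Theta_basis K Q))).
rewrite bilext_suml; under eq_bigr => s _ do rewrite bilext_sumr.
under eq_bigr => s _ do under eq_bigr => t _ do rewrite bilextUU.
have [eq_n|neq_n] := eqVneq (tag P) (tag Q); last first.
  rewrite pairing_num_eq0 // big1 // => s _; rewrite big1 // => t _.
  rewrite /permutation_form; case: eqP => // /(congr1 tag) /= eq_n.
  by rewrite eq_n eqxx in neq_n.
case: P Q eq_n => m P [n Q] /= eq_n; case: _ / eq_n Q => Q.
exact: etrans (congr1 _ (pairing_num_perm P Q)) (sum_permutation_form P Q).
Qed.

Lemma pairing_Theta x y :
  pairing x y = bilext permutation_form (Theta K x) (Theta K y).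
Proof.
have -> : pairing x y =
    bilext (fun P Q => (pairing_num P Q)%:R : K^o)
      (x : {malg K[special_poset]}) (y : {malg K[special_poset]}).
  by rewrite bilextE.
exact: (bilext_comp (u := Theta K) (v := Theta K)
  (w := (idfun : {linear K^o -> K^o})) pairing_num_Theta).
Qed.

End Isometry.

(** * Theta and Upsilon as morphisms of Hopf algebras *)

Section HopfTheta.
Variable K : fieldType.

Lemma perm_ord0 n (s t : 'S_n) : n = 0%N -> s = t.
Proof.
by move=> n0; apply/permP => i; have := ltn_ord i; rewrite [X in (_ < X)%N]n0.
Qed.

Lemma Theta_hopf : hopf_morphism (Theta K).
Proof.
apply: hopf_morphism_basis => [|P Q|P|P].
- apply: etrans (Theta_basis _ _) _; apply: (big_pred1 (1%g : 'S_0)) => s /=.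
  rewrite [s](perm_ord0 _ 1%g) // eqxx.
  by apply/(linear_extensionP (discrete 0)) => -[].
- exact: Theta_mul.
- apply: etrans (congr1 _ (Theta_basis _ _)) _; rewrite /hcounit linear_sum /=.
  under eq_bigr => s _ do rewrite linextU /=.
  case: eqP => tagP; last by rewrite big1.
  rewrite (big_pred1 (1%g : 'S_(tag P))) // => s /=.
  rewrite [s](perm_ord0 _ 1%g) // eqxx.
  by case: P tagP {s} => n P /= n0; apply/(linear_extensionP P) => i;
    have := ltn_ord i; rewrite [X in (_ < X)%N]n0.
- exact: Theta_comul.
Qed.

Lemma hof_incl_basis (F : hof) : hof_incl K << F >> = << hof_val F >>.
Proof. exact: linextU. Qed.

Lemma hof_incl_hopf : hopf_morphism (hof_incl K).
Proof.
apply: hopf_morphism_basis => [|F G|F|F].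
- exact: hof_incl_basis.
- apply: etrans (hof_incl_basis _) _.
  apply: etrans (esym (congr2 (@hmul K (HSP K)) (hof_incl_basis _) (hof_incl_basis _))).
  by symmetry; apply: (bilextUU (fun a b : special_poset => << sp_mul a b >>)).
- apply: etrans (congr1 _ (hof_incl_basis _)) _; exact: linextU.
- apply: etrans (congr1 _ (hof_incl_basis _)) _; apply: etrans (linextU _ _) _.
  rewrite /tensmap [RHS]linear_sum /=; apply: eq_bigr => I _; rewrite linextU /=.
  apply: etrans (esym (congr2 (@tens K _ _) (hof_incl_basis _) (hof_incl_basis _))).
  by symmetry; apply: (bilextUU (fun a b : special_poset => << (a, b) >>)).
Qed.

End HopfTheta.

Theorem theorem4p8 (K : fieldType) :
  [/\ forall P : special_poset,
        exists x : hspace (HHOF K), steps << P >> (hof_incl K x),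
      forall (P : special_poset) (x y : hspace (HHOF K)),
        steps << P >> (hof_incl K x) -> steps << P >> (hof_incl K y) -> x = y &
      exists Upsilon : {linear hspace (HSP K) -> hspace (HHOF K)},
        (forall P : special_poset, steps << P >> (hof_incl K (Upsilon << P >>)))
        /\ [/\ hopf_morphism Upsilon,
               forall x : hspace (HSP K), Theta_hof K (Upsilon x) = Theta K x,
               hopf_isomorphism (Theta_hof K),
               forall x : hspace (HHOF K), Upsilon (hof_incl K x) = x &
               forall x y : hspace (HSP K),
                 pairing (hof_incl K (Upsilon x)) (hof_incl K (Upsilon y))
                   = pairing x y]].
Proof.
have inj_hof : injective (Theta_hof K).
  exact/raddf_inj/Theta_hof_inj.
pose u (P : special_poset) : hspace (HHOF K) := sval (normal_form << P >>).
have uP P : steps << P >> (hof_incl K (u P)) := svalP (normal_form << P >>).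
pose U : {linear hspace (HSP K) -> hspace (HHOF K)} := linext u.
have UE P : U << P >> = u P := linextU _ _.
have ThetaU : Theta_hof K \o U =1 Theta K.
  apply: (linear_ext (f := (Theta_hof K \o U)%FUN)) => P /=.
  apply: etrans (congr1 (Theta_hof K) (UE P)) _; exact: Theta_steps (uP P).
(* Theta maps a chain to a basis element, hence Theta_hof maps its normal form there. *)
pose g : {linear hspace (FQSym K) -> hspace (HHOF K)} :=
  linext (fun s : permutation => U << chain (tagged s) >>).
have gK : cancel g (Theta_hof K).
  apply: (linear_ext (f := (Theta_hof K \o g)%FUN) (g := idfun)) => s /=.
  apply: etrans (congr1 (Theta_hof K) (linextU _ s)) _.
  exact: etrans (ThetaU _) (Theta_chain K s).
have Kg : cancel (Theta_hof K) g by move=> x; apply: inj_hof; rewrite gK.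
have hopf_hof : hopf_morphism (Theta_hof K).
  exact: hopf_morphism_comp (hof_incl_hopf K) (Theta_hopf K).
split.
- by move=> P; exists (u P).
- move=> P x y /Theta_steps eq_x /Theta_steps eq_y; apply: inj_hof.
  exact: etrans eq_x (esym eq_y).
exists U; split=> [P|]; first by apply: eq_ind (uP P) _ _; rewrite UE.
split=> //.
- exact: hopf_morphism_lift Kg hopf_hof (Theta_hopf K) ThetaU.
- by split=> //; exists g.
- by move=> x; apply: inj_hof; apply: ThetaU.
- move=> x y; rewrite !pairing_Theta.
  exact: congr2 (ThetaU x) (ThetaU y).
Qed.
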